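(* Let $G(\mathbb R)_0$ be the Cartan motion group of a connected noncompact real reductive group $G(\mathbb R)$, and let $(\mathfrak g_0,K)$ be its Harish-Chandra pair, $\mathfrak g_0=\mathfrak k\oplus\mathfrak p_0$. An irreducible infinitesimally unitary $(\mathfrak g_0,K)$-module $V$ belongs to the Dirac series of $G(\mathbb R)_0$ (that is, $H_{D_0}(V)\neq 0$) if and only if $\mathfrak p_0$ acts trivially on $V$. Every such module is finite-dimensional.
   Context: Setting. $G$ is a connected complex reductive algebraic group with an antiholomorphic involution $\sigma$ such that $G(\mathbb R):=G^\sigma$ is connected and noncompact; $\theta$ is a corresponding Cartan involution of $G$ (commuting with $\sigma$); $K:=G^\theta$ is a complex reductive algebraic group and $K(\mathbb R):=K^\sigma$ is a maximal compact subgroup of $G(\mathbb R)$ with complexification $K$. Put $\mathfrak g=\mathrm{Lie}(G)$, $\mathfrak k=\mathrm{Lie}(K)$, and let $\mathfrak p$ be the $(-1)$-eigenspace of $\theta$ on $\mathfrak g$; then $\mathfrak g=\mathfrak k\oplus\mathfrak p$, with real forms $\mathfrak g^\sigma=\mathfrak k^\sigma\oplus\mathfrak p^\sigma$. The Cartan motion group is $G(\mathbb R)_0=\mathfrak p^\sigma\rtimes K(\mathbb R)$ (restricted adjoint action). Its complexified Lie algebra is $\mathfrak g_0=\mathfrak k\oplus\mathfrak p_0$ with $\mathfrak p_0=\mathfrak p$ as a $K$-module and bracket $[X_1+Y_1,X_2+Y_2]_0=[Y_1,X_2]+[X_1,Y_2]+[Y_1,Y_2]$ for $X_i\in\mathfrak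 p$, $Y_i\in\mathfrak k$ (so $\mathfrak p_0$ is an abelian ideal); $\mathfrak p_0^\sigma=\mathfrak p^\sigma$ and $\mathfrak g_0^\sigma=\mathfrak k^\sigma\oplus\mathfrak p_0^\sigma$. Form. Fix a symmetric bilinear form $\beta$ on $\mathfrak g$ which restricts to the Killing form on $[\mathfrak g,\mathfrak g]$, is positive definite on $\mathfrak p^\sigma$ and negative definite on $\mathfrak k^\sigma$, and is $\theta$-, $K$- and $\mathfrak g$-invariant. Put $\beta_0=\beta|_{\mathfrak p_0\times\mathfrak p_0}$. Clifford algebra and Dirac operator. $\operatorname{Cl}(\mathfrak p_0,\beta_0)$ is the quotient of the tensor algebra $T(\mathfrak p_0)$ by the two-sided ideal generated by $X\otimes Y+Y\otimes X-\beta_0(X,Y)$; $\gamma_0:\mathfrak p_0\to\operatorname{Cl}(\mathfrak p_0,\beta_0)$ is the canonical embedding. $A_0=\mathcal U(\mathfrak g_0)\otimes_{\mathbb C}\operatorname{Cl}(\mathfrak p_0,\beta_0)$. The Dirac operator is $D_0=\sum_i e_i\otimes\gamma_0(e_i')\in A_0$, for any basis $\{e_i\}$ of $\mathfrak p_0$ with $\beta_0$-dual basis $\{e_i'\}$ (independent of the choice). Spin module. $S_0$ is a fixed simple $\operatorname{Cl}(\mathfrak p_0,\beta_0)$-module, realized on $\bigwedge\mathfrak p_0^-$ with $\mathfrak p_0^-\subset\mathfrak p_0$ a maximal isotropic subspace. Modules and Dirac cohomology. A $(\mathfrak g_0,K)$-module is a complex vector space with a Lie algebra action of $\mathfrak g_0$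 and a locally finite algebraic action of $K$ that are compatible in the usual sense. It is infinitesimally unitary if it carries a positive-definite Hermitian inner product for which $K(\mathbb R)$ acts unitarily and $\mathfrak g_0^\sigma$ acts by skew-Hermitian operators. For a $(\mathfrak g_0,K)$-module $V$, $A_0$ acts on $V\otimes_{\mathbb C}S_0$ factorwise; $D_0(V)$ denotes the operator by which $D_0$ acts, and the Dirac cohomology is $H_{D_0}(V)=\ker D_0(V)/(\ker D_0(V)\cap\operatorname{im}D_0(V))$. The Dirac series of $G(\mathbb R)_0$ is the set of equivalence classes of irreducible infinitesimally unitary $(\mathfrak g_0,K)$-modules $V$ with $H_{D_0}(V)\ne0$. *)

(* Defs.v *)
From HB Require Import structures.
From mathcomp Require Import all_boot all_order all_algebra complex.
From mathcomp Require mpoly.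
From mathcomp Require Import boolp classical_sets reals topology normedtype.
Set Implicit Arguments.
Unset Strict Implicit.
Unset Printing Implicit Defensive.
Import Order.TTheory GRing.Theory Num.Theory.
Import numFieldNormedType.Exports.
Local Open Scope classical_set_scope.
Local Open Scope quotient_scope.
Local Open Scope ring_scope.

(* Typing the complex numbers as a [numClosedFieldType], rather than using
   [R[i]] directly, is what makes their usual topology (and that of complex
   matrices) inferable. *)
Definition Cplx (R : realType) : numClosedFieldType := R[i].

Section LinearAlgebra.
Variables (C : fieldType) (V : lmodType C).

Definition is_subspace (U : set V) : Prop :=
  U 0 /\ forall (a : C) u v, U u -> U v -> U (a *: u + v).

Definition lin_span m (b : 'I_m -> V) : set V :=
  [set v | exists c : 'I_m -> C, v = \sum_i c i *: b i].

Definition lin_indep m (b : 'I_m -> V) : Prop :=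
  forall c : 'I_m -> C, \sum_i c i *: b i = 0 -> forall i, c i = 0.

Definition is_basis (U : set V) m (b : 'I_m -> V) : Prop :=
  lin_indep b /\ lin_span b = U.

Definition finite_dim : Prop := exists m (b : 'I_m -> V), lin_span b = setT.

Definition is_trace_on (U : set V) (f : V -> V) (t : C) : Prop :=
  exists m (b : 'I_m -> V) (A : 'M[C]_m),
    [/\ is_basis U b, forall j, f (b j) = \sum_i A i j *: b i & t = \tr A].

End LinearAlgebra.

Section PresentedAlgebra.
Variables (C : comPzRingType) (X : Type).

Inductive aexpr : Type :=
| ACst of C
| AVar of X
| AAdd of aexpr & aexpr
| AMul of aexpr & aexpr.

Variable rel : aexpr -> aexpr -> Prop.

(* The least congruence containing [rel] whose quotient is an associative
   unital C-algebra. *)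
Inductive acong : aexpr -> aexpr -> Prop :=
| ac_rel x y : rel x y -> acong x y
| ac_refl x : acong x x
| ac_sym x y : acong x y -> acong y x
| ac_trans y x z : acong x y -> acong y z -> acong x z
| ac_add x x' y y' :
    acong x x' -> acong y y' -> acong (AAdd x y) (AAdd x' y')
| ac_mul x x' y y' :
    acong x x' -> acong y y' -> acong (AMul x y) (AMul x' y')
| ac_addA x y z : acong (AAdd x (AAdd y z)) (AAdd (AAdd x y) z)
| ac_addC x y : acong (AAdd x y) (AAdd y x)
| ac_add0 x : acong (AAdd (ACst 0) x) x
| ac_addN x : acong (AAdd (AMul (ACst (-1)) x) x) (ACst 0)
| ac_mulA x y z : acong (AMul x (AMul y z)) (AMul (AMul x y) z)
| ac_mul1l x : acong (AMul (ACst 1) x) x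
| ac_mul1r x : acong (AMul x (ACst 1)) x
| ac_mulDl x y z : acong (AMul (AAdd x y) z) (AAdd (AMul x z) (AMul y z))
| ac_mulDr x y z : acong (AMul x (AAdd y z)) (AAdd (AMul x y) (AMul x z))
| ac_cstD a b : acong (ACst (a + b)) (AAdd (ACst a) (ACst b))
| ac_cstM a b : acong (ACst (a * b)) (AMul (ACst a) (ACst b))
| ac_cstC a x : acong (AMul (ACst a) x) (AMul x (ACst a)).

HB.instance Definition _ := gen_eqMixin aexpr.
HB.instance Definition _ := gen_choiceMixin aexpr.

Definition acongb (x y : aexpr) : bool := `[< acong x y >].

Lemma acongb_equiv : equiv_class_of acongb.
Proof.
split=> [x|x y|y x z]; rewrite /acongb.
- by apply/asboolP; exact: ac_refl.
- by apply/asboolP/asboolP; apply: ac_sym.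
- by move=> /asboolP xy /asboolP yz; apply/asboolP; exact: ac_trans xy yz.
Qed.

Canonical acongb_equivRel := EquivRelPack acongb_equiv.

Definition presalg : Type := {eq_quot acongb}.
HB.instance Definition _ := Choice.on presalg.
HB.instance Definition _ := EqQuotient.on presalg.

Lemma presalg_eqP x y : acong x y <-> \pi_presalg x = \pi_presalg y.
Proof.
split=> [xy|/eqmodP/asboolP//].
by apply/eqmodP/asboolP.
Qed.

Lemma presalg_repr x : acong (repr (\pi_presalg x)) x.
Proof. by apply/presalg_eqP; rewrite reprK. Qed.

Definition pa_cst (a : C) : presalg := \pi_presalg (ACst a).
Definition pa_gen (x : X) : presalg := \pi_presalg (AVar x).
Definition pa_add (u v : presalg) : presalg :=
  \pi_presalg (AAdd (repr u) (repr v)).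
Definition pa_mul (u v : presalg) : presalg :=
  \pi_presalg (AMul (repr u) (repr v)).
Definition pa_opp (u : presalg) : presalg := pa_mul (pa_cst (-1)) u.

Lemma pa_addE x y :
  pa_add (\pi_presalg x) (\pi_presalg y) = \pi_presalg (AAdd x y).
Proof. by apply/presalg_eqP; apply: ac_add; exact: presalg_repr. Qed.

Lemma pa_mulE x y :
  pa_mul (\pi_presalg x) (\pi_presalg y) = \pi_presalg (AMul x y).
Proof. by apply/presalg_eqP; apply: ac_mul; exact: presalg_repr. Qed.

Lemma pa_addA : associative pa_add.
Proof.
elim/quotW=> x; elim/quotW=> y; elim/quotW=> z.
rewrite (pa_addE y z) (pa_addE x y) !pa_addE.
by apply/presalg_eqP; apply: ac_addA.
Qed.

Lemma pa_addC : commutative pa_add.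
Proof.
elim/quotW=> x; elim/quotW=> y.
by rewrite !pa_addE; apply/presalg_eqP; exact: ac_addC.
Qed.

Lemma pa_add0 : left_id (pa_cst 0) pa_add.
Proof. by elim/quotW=> x; rewrite pa_addE; apply/presalg_eqP; exact: ac_add0. Qed.

Lemma pa_addN : left_inverse (pa_cst 0) pa_opp pa_add.
Proof.
elim/quotW=> x; rewrite /pa_opp (pa_mulE _ x) pa_addE.
by apply/presalg_eqP; apply: ac_addN.
Qed.

Lemma pa_mulA : associative pa_mul.
Proof.
elim/quotW=> x; elim/quotW=> y; elim/quotW=> z.
rewrite (pa_mulE y z) (pa_mulE x y) !pa_mulE.
by apply/presalg_eqP; apply: ac_mulA.
Qed.

Lemma pa_mul1l : left_id (pa_cst 1) pa_mul.
Proof. by elim/quotW=> x; rewrite pa_mulE; apply/presalg_eqP; exact: ac_mul1l. Qed.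

Lemma pa_mul1r : right_id (pa_cst 1) pa_mul.
Proof. by elim/quotW=> x; rewrite pa_mulE; apply/presalg_eqP; exact: ac_mul1r. Qed.

Lemma pa_mulDl : left_distributive pa_mul pa_add.
Proof.
elim/quotW=> x; elim/quotW=> y; elim/quotW=> z.
rewrite (pa_addE x y) (pa_mulE x z) (pa_mulE y z) pa_mulE pa_addE.
by apply/presalg_eqP; apply: ac_mulDl.
Qed.

Lemma pa_mulDr : right_distributive pa_mul pa_add.
Proof.
elim/quotW=> x; elim/quotW=> y; elim/quotW=> z.
rewrite (pa_addE y z) (pa_mulE x y) (pa_mulE x z) pa_mulE pa_addE.
by apply/presalg_eqP; apply: ac_mulDr.
Qed.

HB.instance Definition _ :=
  GRing.isZmodule.Build presalg pa_addA pa_addC pa_add0 pa_addN.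
HB.instance Definition _ :=
  GRing.Zmodule_isPzRing.Build presalg pa_mulA pa_mul1l pa_mul1r
    pa_mulDl pa_mulDr.

End PresentedAlgebra.

Section AlgebraicGroups.
Variables (R : realType) (n : nat).
Local Notation C := (Cplx R).
Local Notation M := 'M[Cplx R]_n.

(* The coordinate ring of GL_n is generated by the entries of g and g^-1: a
   polynomial f in 2 n^2 variables is viewed as the regular function
   g |-> f (g, g^-1), whose differential at 1 is X |-> (df)_(1,1) (X, -X). *)
Definition glpoly : Type := mpoly.mpoly (n * n + n * n) C.

Definition glcoord (g h : M) (i : 'I_(n * n + n * n)) : C :=
  row_mx (mxvec g) (mxvec h) ord0 i.

Definition regfun (f : glpoly) (g : M) : C :=
  mpoly.meval (glcoord g (invmx g)) f.

Definition dregfun (f : glpoly) (X : M) : C :=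
  \sum_i mpoly.meval (glcoord 1%:M 1%:M) (mpoly.mderiv i f)
         * glcoord X (- X) i.

Definition zclosed (H : set M) : Prop :=
  exists I : set glpoly,
    H = [set g | g \in unitmx /\ forall f, I f -> regfun f g = 0].

Definition is_subgroup (H : set M) : Prop :=
  [/\ H 1%:M, forall g h, H g -> H h -> H (g *m h)
    & forall g, H g -> H (invmx g)].

Definition alg_group (H : set M) : Prop := zclosed H /\ is_subgroup H.

Definition zconnected (H : set M) : Prop :=
  forall A B : set M, zclosed A -> zclosed B ->
    A `|` B = H -> A `&` B = set0 -> A = set0 \/ B = set0.

Definition unipotent (g : M) : Prop :=
  exists k : nat, (g - 1%:M) ^+ k = 0.

(* Trivial unipotent radical. *)
Definition reductive (H : set M) : Prop :=
  forall U : set M, alg_group U -> zconnected U -> U `<=` H ->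
    (forall g u, H g -> U u -> U (g *m u *m invmx g)) ->
    (forall u, U u -> unipotent u) -> U = [set 1%:M].

Definition lie (H : set M) : set M :=
  [set X | forall f : glpoly,
     (forall g, H g -> regfun f g = 0) -> dregfun f X = 0].

Definition lbr (X Y : M) : M := X *m Y - Y *m X.

Definition Ad (g X : M) : M := g *m X *m invmx g.

(* [regular_on H phi] : phi restricts to a morphism of varieties on H;
   [differential H phi X Y] : moreover its differential at 1 maps X to Y. For X
   in [lie H], Y does not depend on the polynomials representing phi. *)
Definition represents (H : set M) (phi : M -> M) (F : 'I_n -> 'I_n -> glpoly) :=
  forall g, H g -> forall i j, phi g i j = regfun (F i j) g.

Definition regular_on (H : set M) (phi : M -> M) : Prop :=
  exists F, represents H phi F.

Definition differential (H : set M) (phi : M -> M) (X Y : M) : Prop :=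
  exists F, represents H phi F /\ forall i j, Y i j = dregfun (F i j) X.

Definition mxconj (A : M) : M := map_mx Num.conj A.

(* Antiholomorphic maps: the composite with complex conjugation is a morphism of
   varieties. For automorphisms of a connected reductive group this algebraicity
   is automatic. *)
Definition antiregular_on (H : set M) (phi : M -> M) : Prop :=
  regular_on H (mxconj \o phi).

Definition antidifferential (H : set M) (phi : M -> M) (X Y : M) : Prop :=
  differential H (mxconj \o phi) X (mxconj Y).

Definition group_involution (H : set M) (phi : M -> M) : Prop :=
  [/\ forall g, H g -> H (phi g),
      forall g h, H g -> H h -> phi (g *m h) = phi g *m phi h
    & forall g, H g -> phi (phi g) = g].

Definition fixed_points (H : set M) (phi : M -> M) : set M :=
  [set g | H g /\ phi g = g].

Definition real_structure (G : set M) (sigma : M -> M) : Prop :=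
  group_involution G sigma /\ antiregular_on G sigma.

Definition cartan_involution (G : set M) (sigma theta : M -> M) : Prop :=
  [/\ group_involution G theta, regular_on G theta,
      forall g, G g -> sigma (theta g) = theta (sigma g)
    & compact (fixed_points G (sigma \o theta))].

Variables (G : set M) (sigma theta : M -> M).

Definition realgroup : set M := fixed_points G sigma.
Definition Kgroup : set M := fixed_points G theta.
Definition Kreal : set M := fixed_points Kgroup sigma.

Definition pspace : set M :=
  [set X | lie G X /\ differential G theta X (- X)].

Definition real_form (U : set M) : set M :=
  [set X | U X /\ antidifferential G sigma X X].

Definition derived_lie (L : set M) : set M :=
  [set Z | exists m (X Y : 'I_m -> M),
     (forall i, L (X i) /\ L (Y i)) /\ Z = \sum_i lbr (X i) (Y i)].

Record admissible_form (beta : M -> M -> C) : Prop := {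
  form_linear : forall a X Y Z, lie G X -> lie G Y -> lie G Z ->
    beta (a *: X + Y) Z = a * beta X Z + beta Y Z;
  form_sym : forall X Y, lie G X -> lie G Y -> beta X Y = beta Y X;
  form_killing : forall X Y,
    derived_lie (lie G) X -> derived_lie (lie G) Y ->
    is_trace_on (derived_lie (lie G)) (fun Z => lbr X (lbr Y Z)) (beta X Y);
  form_pos : forall X, real_form pspace X -> X != 0 -> 0 < beta X X;
  form_neg : forall X, real_form (lie Kgroup) X -> X != 0 -> beta X X < 0;
  form_theta : forall X Y X' Y', lie G X -> lie G Y ->
    differential G theta X X' -> differential G theta Y Y' ->
    beta X' Y' = beta X Y;
  form_K : forall k X Y, Kgroup k -> lie G X -> lie G Y ->
    beta (Ad k X) (Ad k Y) = beta X Y;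
  form_lie : forall X Y Z, lie G X -> lie G Y -> lie G Z ->
    beta (lbr Z X) Y + beta X (lbr Z Y) = 0 }.

(* An element Y + X of g_0, with Y in k and X in p_0, is the pair (Y, X). *)
Definition g0 : set (M * M) := [set Z | lie Kgroup Z.1 /\ pspace Z.2].

Definition g0_bracket (Z W : M * M) : M * M :=
  (lbr Z.1 W.1, lbr Z.1 W.2 + lbr Z.2 W.1).

Definition g0_Ad (k : M) (Z : M * M) : M * M := (Ad k Z.1, Ad k Z.2).

Definition g0_real : set (M * M) :=
  [set Z | real_form (lie Kgroup) Z.1 /\ real_form pspace Z.2].

(* In the basis b of a K-stable subspace, K acts through the matrix F of
   regular functions. *)
Definition matrix_coefficients (V : lmodType C) (act : M -> V -> V)
    m (b : 'I_m -> V) (F : 'I_m -> 'I_m -> glpoly) : Prop :=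
  lin_indep b /\
  forall k, Kgroup k ->
    forall j, act k (b j) = \sum_i regfun (F i j) k *: b i.

Record g0K_module (V : lmodType C) := {
  gact : M * M -> V -> V;
  kact : M -> V -> V;
  gact_linear : forall Z, g0 Z -> forall a u v,
    gact Z (a *: u + v) = a *: gact Z u + gact Z v;
  gact_linearl : forall Z W, g0 Z -> g0 W -> forall a v,
    gact (a *: Z + W) v = a *: gact Z v + gact W v;
  gact_bracket : forall Z W, g0 Z -> g0 W -> forall v,
    gact (g0_bracket Z W) v = gact Z (gact W v) - gact W (gact Z v);
  kact_linear : forall k, Kgroup k -> forall a u v,
    kact k (a *: u + v) = a *: kact k u + kact k v;
  kact_1 : forall v, kact 1%:M v = v;
  kact_mul : forall k l, Kgroup k -> Kgroup l -> forall v,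
    kact (k *m l) v = kact k (kact l v);
  kact_locally_finite : forall v, exists m (b : 'I_m -> V) F,
    matrix_coefficients kact b F /\ lin_span b v;
  compat_Ad : forall k Z, Kgroup k -> g0 Z -> forall v,
    kact k (gact Z v) = gact (g0_Ad k Z) (kact k v);
  compat_diff : forall m (b : 'I_m -> V) F, matrix_coefficients kact b F ->
    forall Y, lie Kgroup Y ->
    forall j, gact (Y, 0) (b j) = \sum_i dregfun (F i j) Y *: b i }.

Definition irreducible (V : lmodType C) (E : g0K_module V) : Prop :=
  (exists v : V, v != 0) /\
  forall U : set V, is_subspace U ->
    (forall Z v, g0 Z -> U v -> U (gact E Z v)) ->
    (forall k v, Kgroup k -> U v -> U (kact E k v)) ->
    U = [set 0] \/ U = setT.

Definition inf_unitary (V : lmodType C) (E : g0K_module V) : Prop :=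
  exists h : V -> V -> C,
    [/\ (forall a u v w, h (a *: u + v) w = a * h u w + h v w)
          /\ (forall u v, h u v = (h v u)^*),
        forall v, v != 0 -> 0 < h v v,
        forall k u v, Kreal k -> h (kact E k u) (kact E k v) = h u v
      & forall Z u v, g0_real Z -> h (gact E Z u) v = - h u (gact E Z v)].

Definition p0_trivial (V : lmodType C) (E : g0K_module V) : Prop :=
  forall X v, pspace X -> gact E (0, X) v = 0.

Variable beta : M -> M -> C.

(* The linear relations present the tensor algebra T(p_0); the last relation
   generates the ideal defining the Clifford algebra. *)
Inductive clifford_rel : aexpr C pspace -> aexpr C pspace -> Prop :=
| cl_linear a (X Y Z : pspace) : val Z = a *: val X + val Y ->
    clifford_rel (AVar C Z) (AAdd (AMul (ACst _ a) (AVar C X)) (AVar C Y))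
| cl_square (X Y : pspace) :
    clifford_rel
      (AAdd (AMul (AVar C X) (AVar C Y)) (AMul (AVar C Y) (AVar C X)))
      (ACst _ (beta (val X) (val Y))).

Definition clifford : pzRingType := presalg clifford_rel.
Definition gamma0 (X : pspace) : clifford := pa_gen clifford_rel X.

(* A simple module structure on the space C^s of column vectors; a simple
   module over this finite-dimensional algebra is finite-dimensional. *)
Definition simple_module s (rho : {rmorphism clifford -> 'M[C]_s}) : Prop :=
  [/\ forall a, rho (pa_cst clifford_rel a) = a%:M,
      (0 < s)%N
    & forall U : set 'cV[C]_s, is_subspace U ->
        (forall c v, U v -> U (rho c *m v)) -> U = [set 0] \/ U = setT].

Definition dual_bases m (e e' : 'I_m -> pspace) : Prop :=
  [/\ is_basis pspace (val \o e), is_basis pspace (val \o e')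
    & forall i j, beta (val (e i)) (val (e' j)) = (i == j)%:R].

(* V \otimes C^s is identified with V^s, v \otimes x being (x_i v)_i; then
   [tensor_op x A] is the operator x \otimes A. *)
Definition tensor_op (V : lmodType C) s (x : V -> V) (A : 'M[C]_s)
    (w : {ffun 'I_s -> V}) : {ffun 'I_s -> V} :=
  [ffun i => \sum_j A i j *: x (w j)].

(* The action of D_0 = \sum_i e_i \otimes gamma_0(e'_i) on V \otimes S_0. *)
Definition dirac (V : lmodType C) (E : g0K_module V) s
    (rho : {rmorphism clifford -> 'M[C]_s}) m (e e' : 'I_m -> pspace)
    (w : {ffun 'I_s -> V}) : {ffun 'I_s -> V} :=
  \sum_i tensor_op (gact E (0, val (e i))) (rho (gamma0 (e' i))) w.

(* ker D / (ker D \cap im D) is nonzero. *)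
Definition cohomology_neq0 (W : zmodType) (D : W -> W) : Prop :=
  ~ ([set w | D w = 0] `<=` [set w | D w = 0] `&` range D).

End AlgebraicGroups.

(* Main.v *)
Require Import Defs.
From HB Require Import structures.
From mathcomp Require Import all_boot all_order all_algebra complex.
From mathcomp Require Import -(notations) mpoly.
From mathcomp Require Import ring.
From mathcomp Require Import boolp classical_sets reals topology normedtype.
Import Order.TTheory GRing.Theory Num.Theory.
Import numFieldNormedType.Exports.
Local Open Scope classical_set_scope.
Local Open Scope ring_scope.
Set Implicit Arguments.
Unset Strict Implicit.

(* The operators by which p_0 acts on V commute, so the Clifford relations give
   D_0^2 = 1/2 sum_a X_a^2 (x) 1 for a basis (X_a) of p^sigma orthonormal for
   beta. Each X_a acts by a skew-Hermitian operator, so D_0 w = 0 implies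
   0 = sum_a <X_a^2 w_i, w_i> = - sum_a |X_a w_i|^2 for every component w_i of w
   in V, and p_0 kills the w_i. The vectors killed by p_0 form a submodule, since
   p_0 is K-stable and an ideal of g_0, hence by irreducibility p_0 acts
   trivially as soon as ker D_0 <> 0. Conversely, if p_0 acts trivially then
   D_0 = 0, and V is spanned by any nonzero K-stable finite-dimensional
   subspace, which is automatically stable under k. *)

(** * Derivatives of polynomials *)

Section PolynomialDerivation.
Variables (C : comNzRingType).

(** Constants and variables generate the polynomial algebra. Identities between evaluations,
    derivations and substitutions are checked on these generators below. *)
Lemma mpoly_alg_ind k (P : mpoly k C -> Prop) :
  (forall c, P (mpolyC k c)) ->
  (forall i, P (mpolyX C (mnm1 i))) ->
  (forall f g, P f -> P g -> P (f + g)) ->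
  (forall f g, P f -> P g -> P (f * g)) ->
  forall f, P f.
Proof.
move=> PC PX PD PM; elim/mpolyind => [|c m p _ _ IH].
  by rewrite -mpolyC0; apply: PC.
apply: (PD _ _ _ IH); rewrite -mul_mpolyC; apply: (PM) => //.
rewrite mpolyXE_id; elim/big_ind: _ => [||i _].
- by rewrite -mpolyC1; apply: PC.
- exact: PM.
elim: (X in _ ^+ X) => [|j IHj].
  by rewrite expr0 -mpolyC1; apply: PC.
by rewrite exprS; apply: PM.
Qed.

(** The directional derivative at the point v along w; [dregfun] is the case of the point (1, 1) and
    the direction (X, -X). *)
Definition dmeval k (v w : 'I_k -> C) (f : mpoly k C) : C :=
  \sum_i meval v (mderiv i f) * w i.

Lemma dmeval_eq k (v v' w w' : 'I_k -> C) f :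
  v =1 v' -> w =1 w' -> dmeval v w f = dmeval v' w' f.
Proof. by move=> /funext -> /funext ->. Qed.

Lemma dmevalC k (v w : 'I_k -> C) c : dmeval v w (mpolyC k c) = 0.
Proof.
by rewrite /dmeval big1 // => i _; rewrite mderivC meval0 mul0r.
Qed.

Lemma dmevalX k (v w : 'I_k -> C) i :
  dmeval v w (mpolyX C (mnm1 i)) = w i.
Proof.
rewrite /dmeval (bigD1 i) //= big1 ?addr0 => [|j ji].
  rewrite mderivX mevalZ mnm1E eqxx.
  have -> : mnm_sub (mnm1 i) (mnm1 i) = @mnm0 k.
    by apply/mnmP => j; rewrite mnmBE subnn mnm0E.
  by rewrite mpolyX0 meval1 !mul1r.
by rewrite mderivX mnm1E eq_sym (negPf ji) scale0r meval0 mul0r.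
Qed.

Lemma dmevalD k (v w : 'I_k -> C) f g :
  dmeval v w (f + g) = dmeval v w f + dmeval v w g.
Proof.
rewrite /dmeval -big_split; apply: eq_bigr => i _.
by rewrite mderivD mevalD mulrDl.
Qed.

Lemma dmevalM k (v w : 'I_k -> C) f g :
  dmeval v w (f * g) =
  dmeval v w f * meval v g + meval v f * dmeval v w g.
Proof.
rewrite /dmeval mulr_suml mulr_sumr -big_split; apply: eq_bigr => i _ /=.
by rewrite mderivM mevalD !mevalM mulrDl mulrAC mulrA.
Qed.

Lemma dmevalN k (v w : 'I_k -> C) f : dmeval v w (- f) = - dmeval v w f.
Proof.
rewrite /dmeval -sumrN; apply: eq_bigr => i _.
by rewrite mderivN mevalN mulNr.
Qed.

Lemma dmeval_linear k (v w w' : 'I_k -> C) a f :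
  dmeval v (fun i => a * w i + w' i) f = a * dmeval v w f + dmeval v w' f.
Proof.
rewrite /dmeval mulr_sumr -big_split; apply: eq_bigr => i _ /=.
by rewrite mulrDr mulrCA.
Qed.

Definition msubst k l (t : 'I_k -> mpoly l C) (f : mpoly k C) :
  mpoly l C := comp_mpoly [tuple t i | i < k] f.

Lemma msubstX k l (t : 'I_k -> mpoly l C) i :
  msubst t (mpolyX C (mnm1 i)) = t i.
Proof.
by rewrite /msubst comp_mpolyXU -tnth_nth tnth_mktuple.
Qed.

Lemma meval_msubst k l (t : 'I_k -> mpoly l C) v f :
  meval v (msubst t f) = meval (fun i => meval v (t i)) f.
Proof.
rewrite /msubst comp_mpoly_meval; apply: meval_eq => i.
by rewrite tnth_mktuple.
Qed.

(** The chain rule. Both sides obey the same Leibniz rule in f, so agreement on generators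
    suffices. *)
Lemma dmeval_msubst k l (t : 'I_k -> mpoly l C) v w f :
  dmeval v w (msubst t f) =
  dmeval (fun i => meval v (t i)) (fun i => dmeval v w (t i)) f.
Proof.
elim/mpoly_alg_ind: f => [c|i|f g IHf IHg|f g IHf IHg].
- by rewrite /msubst comp_mpolyC !dmevalC.
- by rewrite msubstX dmevalX.
- by rewrite /msubst comp_mpolyD !dmevalD -!/(msubst _ _) IHf IHg.
- rewrite /msubst rmorphM !dmevalM -!/(msubst _ _) IHf IHg.
  by rewrite !meval_msubst.
Qed.

Lemma meval_map k (c : {rmorphism C -> C}) v (f : mpoly k C) :
  meval (c \o v) (map_mpoly c f) = c (meval v f).
Proof.
elim/mpoly_alg_ind: f => [a|i|f g IHf IHg|f g IHf IHg].
- by rewrite map_mpolyC ?mevalC // rmorph0.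
- by rewrite map_mpolyX !mevalXU.
- by rewrite rmorphD !mevalD IHf IHg rmorphD.
- by rewrite rmorphM !mevalM IHf IHg rmorphM.
Qed.

(** Meant for c the complex conjugation, which turns the antiholomorphic [sigma] into a regular
    map. *)
Lemma dmeval_map k (c : {rmorphism C -> C}) v w (f : mpoly k C) :
  dmeval (c \o v) (c \o w) (map_mpoly c f) = c (dmeval v w f).
Proof.
elim/mpoly_alg_ind: f => [a|i|f g IHf IHg|f g IHf IHg].
- by rewrite map_mpolyC ?dmevalC ?rmorph0.
- by rewrite map_mpolyX !dmevalX.
- by rewrite rmorphD !dmevalD IHf IHg rmorphD.
- by rewrite rmorphM !dmevalM IHf IHg !meval_map rmorphD !rmorphM.
Qed.

End PolynomialDerivation.

(** * Differentials of regular homomorphisms *)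

Section RegularMaps.
Variables (R : realType) (n : nat).
Local Notation C := (Cplx R).
Local Notation M := 'M[Cplx R]_n.

Lemma regfunD (f1 f2 : glpoly R n) g :
  regfun (f1 + f2) g = regfun f1 g + regfun f2 g.
Proof. exact: mevalD. Qed.

Lemma regfunM (f1 f2 : glpoly R n) g :
  regfun (f1 * f2) g = regfun f1 g * regfun f2 g.
Proof. exact: mevalM. Qed.

Lemma regfunN (f : glpoly R n) g : regfun (- f) g = - regfun f g.
Proof. exact: mevalN. Qed.

Definition glcst (c : C) : glpoly R n := mpolyC (n * n + n * n) c.

Lemma regfunC c g : regfun (glcst c) g = c.
Proof. exact: mevalC. Qed.

Lemma regfun_sum (I : finType) (f : I -> glpoly R n) g :
  regfun (\sum_i f i) g = \sum_i regfun (f i) g.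
Proof. exact: raddf_sum. Qed.

Lemma dregfunE (f : glpoly R n) X :
  dregfun f X = dmeval (glcoord 1%:M 1%:M) (glcoord X (- X)) f.
Proof. by []. Qed.

Lemma regfun_at1 (f : glpoly R n) :
  meval (glcoord 1%:M 1%:M) f = regfun f 1%:M.
Proof. by rewrite /regfun invmx1. Qed.

Lemma dregfunD (f1 f2 : glpoly R n) X :
  dregfun (f1 + f2) X = dregfun f1 X + dregfun f2 X.
Proof. exact: dmevalD. Qed.

Lemma dregfunM (f1 f2 : glpoly R n) X :
  dregfun (f1 * f2) X =
  dregfun f1 X * regfun f2 1%:M + regfun f1 1%:M * dregfun f2 X.
Proof. by rewrite -!regfun_at1; exact: dmevalM. Qed.

Lemma dregfunN (f : glpoly R n) X : dregfun (- f) X = - dregfun f X.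
Proof. exact: dmevalN. Qed.

Lemma dregfunC c X : dregfun (glcst c) X = 0.
Proof. exact: dmevalC. Qed.

Lemma dregfun_cstl c (f : glpoly R n) X :
  dregfun (glcst c * f) X = c * dregfun f X.
Proof. by rewrite dregfunM dregfunC regfunC mul0r add0r. Qed.

Lemma dregfun_cstr c (f : glpoly R n) X :
  dregfun (f * glcst c) X = dregfun f X * c.
Proof. by rewrite dregfunM dregfunC regfunC mulr0 addr0. Qed.

Lemma dregfun_sum (I : finType) (f : I -> glpoly R n) X :
  dregfun (\sum_i f i) X = \sum_i dregfun (f i) X.
Proof.
have d0 : dregfun (0 : glpoly R n) X = 0 by rewrite -(mpolyC0 _ C) dregfunC.
exact: (big_morph (fun f => dregfun f X) (fun f g => dregfunD f g X) d0).
Qed.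

(** Reduces identities on all coordinates to entries of two matrices. T is arbitrary because f may
    be an evaluation or a derivation on polynomials as well as conjugation on scalars. *)
Lemma glcoord_map (T : Type) (f : T -> C) (A B : 'M[T]_n) (A' B' : M) i :
  (forall a b, f (A a b) = A' a b) -> (forall a b, f (B a b) = B' a b) ->
  f (row_mx (mxvec A) (mxvec B) ord0 i) = glcoord A' B' i.
Proof.
move=> AA' BB'; have <- : map_mx f A = A' by apply/matrixP => a b; rewrite mxE.
have <- : map_mx f B = B' by apply/matrixP => a b; rewrite mxE.
by rewrite /glcoord -!map_mxvec -map_row_mx [RHS]mxE.
Qed.

Lemma glcoord_linear a (A B A' B' : M) i :
  glcoord (a *: A + A') (a *: B + B') i = a * glcoord A B i + glcoord A' B' i.
Proof.
by rewrite /glcoord !linearP -add_row_mx -scale_row_mx [LHS]mxE [X in X + _]mxE.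
Qed.

Lemma dregfun_linear (f : glpoly R n) a X Y :
  dregfun f (a *: X + Y) = a * dregfun f X + dregfun f Y.
Proof.
rewrite !dregfunE -dmeval_linear; apply: dmeval_eq => // i.
by rewrite -glcoord_linear opprD scalerN.
Qed.

Lemma dregfun_opp (f : glpoly R n) X : dregfun f (- X) = - dregfun f X.
Proof.
have := dregfun_linear f (-1) X 0; rewrite addr0 scaleN1r mulN1r => ->.
have := dregfun_linear f (-1) 0 0; rewrite addr0 scaler0 mulN1r.
by rewrite addNr => ->; rewrite addr0.
Qed.

Definition glvar (i j : 'I_n) : glpoly R n :=
  mpolyX C (mnm1 (lshift (n * n) (mxvec_index i j))).
Definition glvarV (i j : 'I_n) : glpoly R n :=
  mpolyX C (mnm1 (rshift (n * n) (mxvec_index i j))).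

Lemma glcoord_l (A B : M) i j :
  glcoord A B (lshift (n * n) (mxvec_index i j)) = A i j.
Proof. by rewrite /glcoord row_mxEl mxvecE. Qed.

Lemma glcoord_r (A B : M) i j :
  glcoord A B (rshift (n * n) (mxvec_index i j)) = B i j.
Proof. by rewrite /glcoord row_mxEr mxvecE. Qed.

Lemma regfun_var i j g : regfun (glvar i j) g = g i j.
Proof. by rewrite /regfun mevalXU glcoord_l. Qed.

Lemma regfun_varV i j g : regfun (glvarV i j) g = invmx g i j.
Proof. by rewrite /regfun mevalXU glcoord_r. Qed.

Lemma dregfun_var i j X : dregfun (glvar i j) X = X i j.
Proof. by rewrite dregfunE dmevalX glcoord_l. Qed.

Lemma dregfun_varV i j X : dregfun (glvarV i j) X = - X i j.
Proof. by rewrite dregfunE dmevalX glcoord_r mxE. Qed.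

Definition glswap_var (i : 'I_(n * n + n * n)) : glpoly R n :=
  row_mx (mxvec (\matrix_(i, j) glvarV i j))
         (mxvec (\matrix_(i, j) glvar i j)) ord0 i.

Lemma meval_glswap_var (g h : M) i :
  meval (glcoord g h) (glswap_var i) = glcoord h g i.
Proof.
by apply: glcoord_map => a b; rewrite mxE mevalXU ?glcoord_l ?glcoord_r.
Qed.

Lemma dmeval_glswap_var v (g h : M) i :
  dmeval v (glcoord g h) (glswap_var i) = glcoord h g i.
Proof.
by apply: glcoord_map => a b; rewrite mxE dmevalX ?glcoord_l ?glcoord_r.
Qed.

(** Pullback along inversion, whose differential at 1 is X |-> -X. *)
Definition glswap (f : glpoly R n) : glpoly R n := msubst glswap_var f.

Lemma regfun_glswap f g : regfun (glswap f) g = regfun f (invmx g).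
Proof.
rewrite /regfun meval_msubst invmxK; apply: meval_eq => i.
exact: meval_glswap_var.
Qed.

Lemma dregfun_glswap f X : dregfun (glswap f) X = - dregfun f X.
Proof.
rewrite -dregfun_opp !dregfunE dmeval_msubst opprK.
apply: dmeval_eq => i; first exact: meval_glswap_var.
exact: dmeval_glswap_var.
Qed.

Definition rmap (F : 'I_n -> 'I_n -> glpoly R n) (g : M) : M :=
  \matrix_(i, j) regfun (F i j) g.
Definition dmap (F : 'I_n -> 'I_n -> glpoly R n) (X : M) : M :=
  \matrix_(i, j) dregfun (F i j) X.

Lemma dmapE F X i j : dmap F X i j = dregfun (F i j) X.
Proof. by rewrite mxE. Qed.

Lemma dmap_linear F a X Y : dmap F (a *: X + Y) = a *: dmap F X + dmap F Y.
Proof. by apply/matrixP => i j; rewrite !mxE dregfun_linear. Qed.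

(* Pulls f back along a group homomorphism phi with coordinates F; the
   coordinates of phi(g)^-1 = phi(g^-1) are those of F with the roles of g and
   g^-1 exchanged. *)
Definition glcomp (F : 'I_n -> 'I_n -> glpoly R n) (f : glpoly R n) :
    glpoly R n :=
  msubst (fun i => row_mx (mxvec (\matrix_(i, j) F i j))
                          (mxvec (\matrix_(i, j) glswap (F i j))) ord0 i) f.

Lemma regfun_glcomp F f g :
  regfun (glcomp F f) g = meval (glcoord (rmap F g) (rmap F (invmx g))) f.
Proof.
rewrite /regfun meval_msubst; apply: meval_eq => i.
apply: (glcoord_map (f := meval (glcoord g (invmx g)))) => a b.
  by rewrite mxE [RHS]mxE.
rewrite mxE [RHS]mxE; exact: regfun_glswap.
Qed.

(** The chain rule at the identity. The condition on F makes (1, 1) go to (1, 1), so that the outer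
    derivative is again taken at the identity. *)
Lemma dregfun_glcomp F f X : rmap F 1%:M = 1%:M ->
  dregfun (glcomp F f) X = dregfun f (dmap F X).
Proof.
move=> F1; rewrite !dregfunE dmeval_msubst.
have F1E a b : regfun (F a b) 1%:M = 1%:M a b by rewrite -[in RHS]F1 mxE.
apply: dmeval_eq => i; apply: glcoord_map => a b; rewrite !mxE.
- by rewrite regfun_at1 F1E mxE.
- by rewrite regfun_at1 regfun_glswap invmx1 F1E mxE.
- by [].
- exact: dregfun_glswap.
Qed.

Definition glconj (f : glpoly R n) : glpoly R n := map_mpoly (@Num.conj C) f.

Lemma regfun_glconj f g : regfun (glconj f) (mxconj g) = (regfun f g)^*.
Proof.
rewrite /regfun -meval_map; apply: meval_eq => i /=.
by apply/esym/glcoord_map => a b; rewrite -?map_invmx [RHS]mxE.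
Qed.

Lemma dregfun_glconj f X : dregfun (glconj f) (mxconj X) = (dregfun f X)^*.
Proof.
rewrite !dregfunE -dmeval_map; apply: dmeval_eq => i /=; apply/esym;
  apply: glcoord_map => a b; by rewrite !mxE ?rmorph_nat ?rmorphN.
Qed.

(** The difference f1 - f2 lies in the ideal of H, which X annihilates. This is what makes
    differentials independent of the chosen coordinates. *)
Lemma lie_eq (H : set M) f1 f2 X : lie H X ->
  (forall g, H g -> regfun f1 g = regfun f2 g) -> dregfun f1 X = dregfun f2 X.
Proof.
move=> HX f12; apply/eqP; rewrite -subr_eq0 -dregfunN -dregfunD; apply/eqP.
by apply: HX => g Hg; rewrite regfunD regfunN f12 ?subrr.
Qed.

(** Weaker than [alg_group], so that it passes at once to the complex conjugate of a group. *)
Definition matrix_group (H : set M) : Prop :=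
  is_subgroup H /\ forall g, H g -> g \in unitmx.

Definition is_hom (H H' : set M) (phi : M -> M) : Prop :=
  (forall g, H g -> H' (phi g)) /\
  (forall g h, H g -> H h -> phi (g *m h) = phi g *m phi h).

Section Homomorphism.
Variables (H H' : set M) (phi : M -> M) (F : 'I_n -> 'I_n -> glpoly R n).
Hypotheses (groupH : matrix_group H) (groupH' : matrix_group H').
Hypotheses (phiH : is_hom H H' phi) (phiF : represents H phi F).

Lemma rmap_represents g : H g -> rmap F g = phi g.
Proof. by move=> Hg; apply/matrixP => i j; rewrite mxE phiF. Qed.

Lemma hom1 : phi 1%:M = 1%:M.
Proof.
have [[H1 _ _] _] := groupH; have [phiM phiMM] := phiH.
have u1 := groupH'.2 _ (phiM _ H1).
have := congr1 (mulmx (invmx (phi 1%:M))) (phiMM _ _ H1 H1).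
by rewrite mul1mx mulKmx // mulVmx // => <-.
Qed.

Lemma homV g : H g -> phi (invmx g) = invmx (phi g).
Proof.
move=> Hg; have [[H1 _ HV] uH] := groupH; have [phiM phiMM] := phiH.
have ug := groupH'.2 _ (phiM _ Hg).
have := congr1 (mulmx (invmx (phi g))) (phiMM _ _ Hg (HV _ Hg)).
by rewrite mulmxV ?uH // hom1 mulmx1 mulKmx // => <-.
Qed.

Lemma rmap_represents1 : rmap F 1%:M = 1%:M.
Proof. by rewrite rmap_represents ?hom1 //; have [[]] := groupH. Qed.

Lemma regfun_pullback f g : H g -> regfun (glcomp F f) g = regfun f (phi g).
Proof.
move=> Hg; have [[_ _ /(_ g Hg) HVg] _] := groupH.
by rewrite regfun_glcomp (rmap_represents Hg) (rmap_represents HVg) homV.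
Qed.

(** A function vanishing on H' pulls back to one vanishing on H, and the chain rule transfers the
    derivative. *)
Lemma lie_dmap X : lie H X -> lie H' (dmap F X).
Proof.
move=> HX f f0; rewrite -(dregfun_glcomp _ _ rmap_represents1).
by apply: HX => g Hg; rewrite regfun_pullback // f0 //; apply: phiH.1.
Qed.

(** Functoriality of the differential. Q may be any coordinates of the composite, since on the Lie
    algebra their choice does not matter; a map factored in two ways thus yields an identity of
    differentials. *)
Lemma dmap_comp psi chi P Q X :
  represents H' psi P -> represents H chi Q ->
  (forall g, H g -> chi g = psi (phi g)) ->
  lie H X -> dmap Q X = dmap P (dmap F X).
Proof.
move=> psiP chiQ chiE HX; apply/matrixP => i j; rewrite [LHS]dmapE [RHS]dmapE.
rewrite -(dregfun_glcomp _ _ rmap_represents1).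
apply: (lie_eq HX) => g Hg.
rewrite (regfun_pullback _ Hg) -(chiQ g Hg) (chiE g Hg).
exact: psiP (phiH.1 g Hg) i j.
Qed.

End Homomorphism.

Lemma dmap_unique (H : set M) phi F F' X :
  represents H phi F -> represents H phi F' -> lie H X -> dmap F X = dmap F' X.
Proof.
move=> phiF phiF' HX; apply/matrixP => i j; rewrite [LHS]dmapE [RHS]dmapE.
by apply: (lie_eq HX) => g Hg; rewrite -(phiF g Hg) -(phiF' g Hg).
Qed.

(** Removes the existential over coordinates from [differential]: one fixed F computes it. *)
Lemma differentialP (H : set M) phi F X Y :
  represents H phi F -> lie H X -> differential H phi X Y <-> Y = dmap F X.
Proof.
move=> phiF HX; split=> [[F' [phiF' YE]]|->].
  rewrite (dmap_unique phiF phiF' HX).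
  by apply/matrixP => i j; rewrite dmapE YE.
by exists F; split=> // i j; rewrite dmapE.
Qed.

Lemma mxconjK : involutive (@mxconj R n).
Proof. by move=> A; apply/matrixP => i j; rewrite !mxE conjCK. Qed.

Lemma dmap_glconj F X :
  dmap (fun i j => glconj (F i j)) (mxconj X) = mxconj (dmap F X).
Proof. by apply/matrixP => i j; rewrite [LHS]dmapE dregfun_glconj !mxE. Qed.

End RegularMaps.

(** * Stability of p under K and k *)

Section AdjointAction.
Variables (R : realType) (n : nat).
Local Notation C := (Cplx R).
Local Notation M := 'M[Cplx R]_n.

Definition Ad_coord (k : M) (i j : 'I_n) : glpoly R n :=
  \sum_b (\sum_a glcst n (k i a) * glvar R a b) * glcst n (invmx k b j).

Lemma Ad_coordE k g i j : Ad k g i j = regfun (Ad_coord k i j) g.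
Proof.
rewrite regfun_sum !mxE; apply: eq_bigr => b _.
rewrite regfunM regfunC regfun_sum mxE; congr (_ * _); apply: eq_bigr => a _.
by rewrite regfunM regfunC regfun_var.
Qed.

(** Conjugation by a fixed k is linear in the entries of g, hence is its own differential. *)
Lemma dmap_Ad k X : dmap (Ad_coord k) X = Ad k X.
Proof.
apply/matrixP => i j; rewrite dmapE dregfun_sum !mxE; apply: eq_bigr => b _.
rewrite dregfun_cstr dregfun_sum mxE; congr (_ * _).
apply: eq_bigr => a _.
by rewrite dregfun_cstl dregfun_var.
Qed.

Lemma Ad_hom (H H' : set M) k : (forall g, H g -> H' (Ad k g)) ->
  k \in unitmx -> is_hom H H' (Ad k).
Proof.
by move=> HH' uk; split=> // g h _ _; rewrite /Ad !mulmxA mulmxKV.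
Qed.

Lemma AdK (k X : M) : k \in unitmx -> Ad k (Ad (invmx k) X) = X.
Proof. by move=> uk; rewrite /Ad invmxK !mulmxA mulmxV // mul1mx mulmxK. Qed.

(** Coordinates of the orbit map g |-> g X g^-1: here X is fixed and g varies, the opposite of
    [Ad_coord]. *)
Definition Ad_orbit_coord (X : M) (i j : 'I_n) : glpoly R n :=
  \sum_b (\sum_a glvar R i a * glcst n (X a b)) * glvarV R b j.

Lemma regfun_Ad_orbit X g i j :
  regfun (Ad_orbit_coord X i j) g = Ad g X i j.
Proof.
rewrite regfun_sum !mxE; apply: eq_bigr => b _.
rewrite regfunM regfun_varV regfun_sum mxE; congr (_ * _).
by apply: eq_bigr => a _; rewrite regfunM regfunC regfun_var.
Qed.

(** By the Leibniz rule at g = 1, the factor g contributes Y X and the factor g^-1 contributes - X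
    Y. *)
Lemma dregfun_Ad_orbit X Y i j :
  dregfun (Ad_orbit_coord X i j) Y = lbr Y X i j.
Proof.
rewrite dregfun_sum !mxE -sumrN.
under eq_bigr => b _ do rewrite dregfunM dregfun_varV regfun_varV invmx1.
rewrite big_split /=; congr (_ + _).
  rewrite (bigD1 j) //= [X in _ + X]big1 => [|b /negPf bj].
    rewrite mxE eqxx mulr1n [LHS]addr0 [LHS]mulr1 dregfun_sum.
    apply: eq_bigr => a _.
    by rewrite dregfun_cstr dregfun_var.
  by rewrite mxE bj mulr0.
apply: eq_bigr => b _; rewrite mulrN; congr (- (_ * _)).
rewrite regfun_sum (bigD1 i) //= big1 => [|a /negPf ai].
  by rewrite regfunM regfunC regfun_var mxE eqxx mulr1n [LHS]addr0 [LHS]mul1r.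
by rewrite regfunM regfun_var mxE eq_sym ai mul0r.
Qed.

(** U becomes the row space of a matrix B. Since Z lies outside it, some column of [cokermx B] is
    nonzero on Z, and every such column kills U. *)
Lemma separating_functional (U : set M) m (b : 'I_m -> M) Z :
  lin_span b = U -> ~ U Z -> exists L : 'I_(n * n) -> C,
  (forall X, U X -> \sum_k L k * mxvec X ord0 k = 0) /\
  \sum_k L k * mxvec Z ord0 k != 0.
Proof.
move=> <- nZ; pose B := \matrix_i mxvec (b i) : 'M[C]_(m, n * n).
have inB X : (mxvec X <= B)%MS <-> lin_span b X.
  split=> [/submxP [D XE]|[c ->]].
    exists (fun i => D ord0 i); apply: (can_inj mxvecK).
    rewrite XE linear_sum /= mulmx_sum_row; apply: eq_bigr => i _.
    by rewrite linearZ rowK.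
  rewrite linear_sum; apply: summx_sub => i _ /=.
  by rewrite linearZ; apply: scalemx_sub; have := row_sub i B; rewrite rowK.
have [c nc] : exists c, (mxvec Z *m cokermx B) ord0 c != 0.
  apply: contrapT => H; apply: nZ; apply/inB; rewrite submxE; apply/eqP.
  apply/rowP => c; rewrite [RHS]mxE; apply/eqP; apply: contrapT => /negP nc.
  by apply: H; exists c.
have LE X : \sum_k cokermx B k c * mxvec X ord0 k =
    (mxvec X *m cokermx B) ord0 c.
  by rewrite mxE; apply: eq_bigr => k _; rewrite mulrC.
exists (fun k => cokermx B k c); rewrite LE; split=> // X /inB.
by rewrite LE submxE => /eqP ->; rewrite mxE.
Qed.

(* A linear functional l that vanishes on U gives the function l(Ad g X) on H,
   which vanishes identically; its differential at 1 is Y |-> l([Y, X]). *)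
Lemma lbr_stable (H U : set M) m (b : 'I_m -> M) :
  lin_span b = U -> (forall k X, H k -> U X -> U (Ad k X)) ->
  forall X Y, lie H Y -> U X -> U (lbr Y X).
Proof.
move=> bU HU X Y HY UX; apply: contrapT => /(separating_functional bU) [L [L0]].
(* Moves f inside [mxvec]; needed both for evaluation at g and for differentiation along Y. *)
have q_map (f : glpoly R n -> C) k :
    f (mxvec (\matrix_(i, j) Ad_orbit_coord X i j) ord0 k) =
    mxvec (\matrix_(i, j) f (Ad_orbit_coord X i j)) ord0 k.
  transitivity (map_mx f (mxvec (\matrix_(i, j) Ad_orbit_coord X i j)) ord0 k).
    by rewrite [RHS]mxE.
  rewrite map_mxvec; congr (mxvec _ _ _).
  by apply/matrixP => i j; rewrite !mxE.
have /(HY _) : forall g, H g -> regfun (\sum_k glcst n (L k) *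
    mxvec (\matrix_(i, j) Ad_orbit_coord X i j) ord0 k) g = 0.
  move=> g Hg; rewrite regfun_sum -[RHS](L0 (Ad g X) (HU _ _ Hg UX)).
  apply: eq_bigr => k _; rewrite regfunM regfunC (q_map (fun f => regfun f g)).
  congr (_ * mxvec _ _ _); apply/matrixP => i j; rewrite mxE.
  exact: regfun_Ad_orbit.
rewrite dregfun_sum => S0 /eqP []; rewrite -[RHS]S0.
apply: eq_bigr => k _; rewrite dregfun_cstl.
rewrite (q_map (fun f => dregfun f Y)).
congr (_ * mxvec _ _ _); apply/matrixP => i j; rewrite [RHS]mxE.
by rewrite dregfun_Ad_orbit.
Qed.

End AdjointAction.

Section CartanDecomposition.
Variables (R : realType) (n : nat).
Local Notation C := (Cplx R).
Local Notation M := 'M[Cplx R]_n.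
Variables (G : set M) (sigma theta : M -> M).
Hypothesis algG : alg_group G.

Lemma alg_matrix_group : matrix_group G.
Proof. by have [[I ->] sub] := algG; split=> // g []. Qed.

Lemma pspaceP P X : represents G theta P ->
  pspace G theta X <-> lie G X /\ dmap P X = - X.
Proof.
move=> thetaP; split=> [[GX /(differentialP _ thetaP GX)]|[GX XE]]; first by [].
by split=> //; apply/(differentialP _ thetaP GX).
Qed.

(** The antilinear differential of [sigma] is X |-> [mxconj (dmap F X)], and real vectors are its
    fixed points. *)
Lemma real_pspaceP F X : represents G (@mxconj R n \o sigma) F ->
  real_form G sigma (pspace G theta) X <->
  pspace G theta X /\ dmap F X = mxconj X.
Proof.
move=> sigmaF; split=> [[pX]|[pX XE]].
  by move=> /(differentialP _ sigmaF pX.1).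
by split=> //; apply/(differentialP _ sigmaF pX.1).
Qed.

Hypothesis thetaH : group_involution G theta.

Lemma Kgroup_unit k : Kgroup G theta k -> k \in unitmx.
Proof. by case=> Gk _; apply: alg_matrix_group.2. Qed.

Lemma KgroupV k : Kgroup G theta k -> Kgroup G theta (invmx k).
Proof.
case=> Gk tk; have GG := alg_matrix_group; have [[_ _ GV] _] := GG.
split; first exact: GV.
have hom_theta : is_hom G G theta by case: thetaH.
by rewrite (homV GG GG hom_theta) // tk.
Qed.

(** Since [theta] fixes k, it commutes with conjugation by k on G, and hence so do the
    differentials. *)
Lemma Ad_pspace k X : regular_on G theta ->
  Kgroup G theta k -> pspace G theta X -> pspace G theta (Ad k X).
Proof.
move=> [P thetaP] Kk /(pspaceP _ thetaP) [GX XE]; apply/(pspaceP _ thetaP).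
have GG := alg_matrix_group; have [[_ GM GV] _] := GG.
have uk := Kgroup_unit Kk; have Gk := Kk.1.
have homk : is_hom G G (Ad k).
  by apply: Ad_hom => // g Gg; apply: GM (GM _ _ Gk Gg) (GV _ Gk).
have repk : represents G (Ad k) (Ad_coord k).
  by move=> g _ i j; apply: Ad_coordE.
have [tG tM tK] := thetaH; have homt : is_hom G G theta by [].
have Vk := KgroupV Kk.
rewrite -dmap_Ad; split; first exact: lie_dmap repk _ GX.
(* On G this map is also [Ad k] after [theta]; its differential is computed from both
   factorizations. *)
pose chi g := theta (Ad k g); pose Q i j := glcomp (Ad_coord k) (P i j).
have chiQ : represents G chi Q.
  move=> g Gg i j; rewrite (regfun_pullback GG GG homk repk) //.
  by rewrite -thetaP //; apply: homk.1.
rewrite -(dmap_comp GG GG homk repk thetaP chiQ) //.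
rewrite (dmap_comp GG GG homt thetaP repk chiQ) // => [|g Gg].
  by rewrite XE !dmap_Ad /Ad mulmxN mulNmx.
have Gkg := GM _ _ Gk Gg; have GVk := GV _ Gk.
by rewrite /chi /Ad (tM _ _ Gkg GVk) (tM _ _ Gk Gg) Kk.2 Vk.2.
Qed.

End CartanDecomposition.

(** * The real form of p spans p *)

Section RealStructure.
Variables (R : realType) (n : nat).
Local Notation C := (Cplx R).
Local Notation M := 'M[Cplx R]_n.

Lemma mxconj_linear a (X Y : M) :
  mxconj (a *: X + Y) = a^* *: mxconj X + mxconj Y.
Proof. by rewrite /mxconj map_mxD map_mxZ. Qed.

Lemma mxconjN (X : M) : mxconj (- X) = - mxconj X.
Proof. exact: map_mxN. Qed.

Lemma dmap0 (F : 'I_n -> 'I_n -> glpoly R n) : dmap F 0 = 0.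
Proof.
by have := dmap_linear F (-1) 0 0; rewrite addr0 scaler0 scaleN1r addNr.
Qed.

Lemma dmapZ (F : 'I_n -> 'I_n -> glpoly R n) a X :
  dmap F (a *: X) = a *: dmap F X.
Proof. by rewrite -[a *: X]addr0 dmap_linear dmap0 addr0. Qed.

Lemma lie_linear (H : set M) a X Y : lie H X -> lie H Y -> lie H (a *: X + Y).
Proof. by move=> HX HY f f0; rewrite dregfun_linear HX ?HY ?mulr0 ?addr0. Qed.

Lemma lie0 (H : set M) : lie H 0.
Proof.
move=> f f0; have := dregfun_linear f (-1) 0 0.
by rewrite scaler0 addr0 mulN1r addNr.
Qed.

(** The complex conjugate group. For H = G it is the target of the regular homomorphism
    [mxconj \o sigma]. *)
Definition conj_set (H : set M) : set M := [set g | H (mxconj g)].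

Lemma conj_matrix_group H : matrix_group H -> matrix_group (conj_set H).
Proof.
move=> [[H1 HM HV] uH]; split; last first.
  by move=> g /uH; rewrite /mxconj map_unitmx.
split=> [|g h Hg Hh|g Hg]; rewrite /conj_set /mxconj /=.
- by rewrite map_mx1.
- by rewrite map_mxM; apply: HM.
- by rewrite map_invmx; apply: HV.
Qed.

Lemma lie_conj_set H X : lie (conj_set H) X -> lie H (mxconj X).
Proof.
move=> HX f f0; rewrite -[LHS]conjCK -dregfun_glconj mxconjK HX ?rmorph0 //.
by move=> g Hg; rewrite -[g]mxconjK regfun_glconj f0 ?rmorph0.
Qed.

Lemma represents_conj H phi F : represents H phi F ->
  represents (conj_set H) (fun g => mxconj (phi (mxconj g)))
             (fun i j => glconj (F i j)).
Proof.
move=> phiF g Hg i j; rewrite mxE (phiF _ Hg) -regfun_glconj.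
by rewrite mxconjK.
Qed.

Variables (G : set M) (sigma theta : M -> M).
Hypothesis algG : alg_group G.
Hypothesis sigmaG : real_structure G sigma.

Lemma pspace_linear a X Y : regular_on G theta ->
  pspace G theta X -> pspace G theta Y -> pspace G theta (a *: X + Y).
Proof.
move=> [P thetaP] /(pspaceP _ thetaP) [GX XE] /(pspaceP _ thetaP) [GY YE].
apply/(pspaceP _ thetaP); split; first exact: lie_linear.
by rewrite dmap_linear XE YE scalerN opprD.
Qed.

Lemma real_pspace_linear a X Y : regular_on G theta -> a^* = a ->
  real_form G sigma (pspace G theta) X ->
  real_form G sigma (pspace G theta) Y ->
  real_form G sigma (pspace G theta) (a *: X + Y).
Proof.
move=> regt ra; have [_ [F sigmaF]] := sigmaG.
move=> /(real_pspaceP _ _ sigmaF) [pX XE] /(real_pspaceP _ _ sigmaF) [pY YE].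
apply/(real_pspaceP _ _ sigmaF); split; first exact: pspace_linear.
by rewrite dmap_linear mxconj_linear XE YE ra.
Qed.

(** The differential of [sigma] preserves p because [sigma] commutes with [theta], and it is an
    involution because [sigma] is one. *)
Lemma pspace_conj F X : group_involution G theta -> regular_on G theta ->
  (forall g, G g -> sigma (theta g) = theta (sigma g)) ->
  represents G (@mxconj R n \o sigma) F -> pspace G theta X ->
  pspace G theta (mxconj (dmap F X)) /\
  dmap F (mxconj (dmap F X)) = mxconj X.
Proof.
move=> thetaG [P thetaP] comm sigmaF /(pspaceP _ thetaP) [GX XE].
have GG := alg_matrix_group algG; have GG' := conj_matrix_group GG.
have [[sG sM sK] _] := sigmaG; have [tG tM tK] := thetaG.
have homs : is_hom G (conj_set G) (@mxconj R n \o sigma).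
  split=> [g Gg|g h Gg Gh]; first by rewrite /conj_set /= mxconjK; apply: sG.
  by rewrite /= sM // /mxconj map_mxM.
have homt : is_hom G G theta by [].
split.
  apply/(pspaceP _ thetaP); split.
    by apply: lie_conj_set; apply: (lie_dmap GG GG' homs sigmaF).
  (* By commutation this is also [mxconj \o sigma] followed by the conjugate of [theta], a regular
     map on the conjugate group. *)
  pose chi g := mxconj (sigma (theta g)); pose Q i j := glcomp P (F i j).
  have chiQ : represents G chi Q.
    move=> g Gg i j; rewrite (regfun_pullback GG GG homt thetaP _ Gg) -sigmaF //.
    exact: tG.
  apply: (can_inj (@mxconjK R n)); rewrite -dmap_glconj mxconjK.
  rewrite -(dmap_comp GG GG' homs sigmaF (represents_conj thetaP) chiQ _ GX).
    rewrite (dmap_comp GG GG homt thetaP sigmaF chiQ _ GX) // XE.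
    by rewrite -scaleN1r dmapZ scaleN1r mxconjN mxconjK.
  by move=> g Gg; rewrite /chi /= mxconjK comm.
(* The identity of G factors as [mxconj \o sigma] followed by its own conjugate. *)
have repid : represents G id (@glvar R n).
  by move=> g _ i j; rewrite regfun_var.
apply: (can_inj (@mxconjK R n)); rewrite -dmap_glconj !mxconjK.
rewrite -(dmap_comp GG GG' homs sigmaF (represents_conj sigmaF) repid _ GX).
  by apply/matrixP => i j; rewrite dmapE dregfun_var.
by move=> g Gg; rewrite /= !mxconjK sK.
Qed.

Lemma pspace_real_decomposition X : cartan_involution G sigma theta ->
  pspace G theta X -> exists A B,
  [/\ real_form G sigma (pspace G theta) A,
      real_form G sigma (pspace G theta) B & X = A + 'i *: B].
Proof.
move=> [thetaG regt comm _] pX; have [_ [F sigmaF]] := sigmaG.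
have [] := pspace_conj thetaG regt comm sigmaF pX.
set Y := mxconj (dmap F X) => pY YE.
have XE : dmap F X = mxconj Y by rewrite mxconjK.
have p0 : pspace G theta 0.
  by have := pspace_linear (-1) regt pX pX; rewrite scaleN1r addNr.
have comb a b : pspace G theta (a *: X + b *: Y).
  apply: pspace_linear => //; rewrite -[_ *: Y]addr0; exact: pspace_linear.
have dcomb a b : dmap F (a *: X + b *: Y) = a *: mxconj Y + b *: mxconj X.
  by rewrite dmap_linear XE dmapZ YE.
have ccomb a b : mxconj (a *: X + b *: Y) = a^* *: mxconj X + b^* *: mxconj Y.
  by rewrite /mxconj map_mxD !map_mxZ.
have half : (2^-1 : C)^* = 2^-1 by rewrite fmorphV rmorph_nat.
have iE : (- 'i / 2 : C)^* = 'i / 2.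
  by rewrite rmorphM /= half rmorphN /= conjCi opprK.
have iE' : ('i / 2 : C)^* = - 'i / 2 by rewrite -iE conjCK.
(* Y is the image of X under the differential of [sigma]; these are (X + Y) / 2 and (X - Y) / (2
   i). *)
exists (2^-1 *: X + 2^-1 *: Y), (- 'i / 2 *: X + 'i / 2 *: Y); split.
- apply/(real_pspaceP _ _ sigmaF); split; first exact: comb.
  by rewrite dcomb ccomb half addrC.
- apply/(real_pspaceP _ _ sigmaF); split; first exact: comb.
  by rewrite dcomb ccomb iE iE' addrC.
rewrite scalerDr !scalerA !mulrA mulrN -expr2 sqrCi opprK mul1r mulN1r.
rewrite addrACA -!scalerDl subrr scale0r addr0.
by have := splitr (1 : C); rewrite !mul1r => <-; rewrite scale1r.
Qed.

End RealStructure.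

(** * Real orthonormal bases *)

Section OrthonormalBasis.
Variables (C : numClosedFieldType) (V : lmodType C) (U Ur : set V).
Variable beta : V -> V -> C.
Hypotheses (U_sub : is_subspace U)
  (beta_linear : forall a X Y Z, U X -> U Y -> U Z ->
     beta (a *: X + Y) Z = a * beta X Z + beta Y Z)
  (beta_sym : forall X Y, U X -> U Y -> beta X Y = beta Y X).

Lemma subspace0 : U 0. Proof. exact: U_sub.1. Qed.

Lemma subspace_lin a X Y : U X -> U Y -> U (a *: X + Y).
Proof. exact: U_sub.2. Qed.

Lemma subspaceZ a X : U X -> U (a *: X).
Proof.
move=> UX; rewrite -[_ *: _]addr0; apply: subspace_lin => //.
exact: subspace0.
Qed.

Lemma subspaceD X Y : U X -> U Y -> U (X + Y).
Proof. by move=> UX UY; rewrite -[X]scale1r; apply: subspace_lin. Qed.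

Lemma form0 Z : U Z -> beta 0 Z = 0.
Proof.
move=> UZ; have := beta_linear (-1) subspace0 subspace0 UZ.
by rewrite scaler0 addr0 mulN1r addNr.
Qed.

Lemma formD X Y Z : U X -> U Y -> U Z -> beta (X + Y) Z = beta X Z + beta Y Z.
Proof. by move=> UX UY UZ; rewrite -[X]scale1r beta_linear // mul1r scale1r. Qed.

Lemma formZ a X Z : U X -> U Z -> beta (a *: X) Z = a * beta X Z.
Proof.
move=> UX UZ; rewrite -[_ *: _]addr0 beta_linear ?form0 ?addr0 //.
exact: subspace0.
Qed.

Lemma form_sum k (c : 'I_k -> C) (x : 'I_k -> V) Z :
  (forall i, U (x i)) -> U Z ->
  beta (\sum_i c i *: x i) Z = \sum_i c i * beta (x i) Z.
Proof.
move=> Ux UZ.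
have [] // : U (\sum_i c i *: x i) /\
  beta (\sum_i c i *: x i) Z = \sum_i c i * beta (x i) Z.
elim/big_ind2: _ => [|X s Y t [UX <-] [UY <-]|i _].
- by rewrite form0 //; split=> //; apply: subspace0.
- by rewrite formD //; split=> //; apply: subspaceD.
- by rewrite formZ //; split=> //; apply: subspaceZ.
Qed.

Hypotheses (UrU : Ur `<=` U)
  (Ur_linear : forall a X Y, a^* = a -> Ur X -> Ur Y -> Ur (a *: X + Y))
  (beta_pos : forall X, Ur X -> X != 0 -> 0 < beta X X)
  (U_real : forall X, U X -> exists A B, [/\ Ur A, Ur B & X = A + 'i *: B]).

Lemma real_part0 : Ur 0.
Proof.
have [A [B [UA _ _]]] := U_real subspace0.
have := Ur_linear (a := -1) _ UA UA; rewrite scaleN1r addNr; apply.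
by rewrite rmorphN1.
Qed.

(** By polarization, 2 [beta X Y] is a combination of values [beta Z Z] with Z in [Ur], which are
    nonnegative. *)
Lemma form_real X Y : Ur X -> Ur Y -> (beta X Y)^* = beta X Y.
Proof.
move=> UX UY; have ge0 Z : Ur Z -> 0 <= beta Z Z.
  move=> UZ; have [->|nZ] := eqVneq Z 0.
    by rewrite form0 ?lexx //; apply: subspace0.
  exact/ltW/beta_pos.
have UXY : Ur (X + Y).
  by rewrite -[X]scale1r; apply: Ur_linear; rewrite ?rmorph1.
have E : beta (X + Y) (X + Y) - beta X X - beta Y Y = 2 * beta X Y.
  have [uX uY uXY] := And3 (UrU UX) (UrU UY) (UrU UXY).
  rewrite formD // [beta X (_ + _)]beta_sym // [beta Y (_ + _)]beta_sym //.
  rewrite !formD // [beta Y X]beta_sym //.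
  by ring.
apply/CrealP; have : 2 * beta X Y \is Num.real.
  by rewrite -E !rpredB // ger0_real // ge0.
by rewrite realMr ?realn ?pnatr_eq0.
Qed.

(** The form is bilinear, not Hermitian, and its positivity is available only on [Ur]; hence the
    vectors are taken there. *)
Definition real_orthonormal k (x : 'I_k -> V) : Prop :=
  (forall a, Ur (x a)) /\ forall a b, beta (x a) (x b) = (a == b)%:R.

Lemma span_subset m (e : 'I_m -> V) i : lin_span e = U -> U (e i).
Proof.
move=> <-; exists (fun j => (i == j)%:R); rewrite (bigD1 i) //= eqxx scale1r.
by rewrite big1 ?addr0 // => j /negPf ji; rewrite eq_sym ji scale0r.
Qed.

(** Expanding the x in the spanning family e factors the k by k identity matrix through dimension
    m. *)
Lemma orthonormal_size k (x : 'I_k -> V) m (e : 'I_m -> V) :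
  lin_span e = U -> real_orthonormal x -> (k <= m)%N.
Proof.
move=> eU [Ux x1]; have Ue i : U (e i) by exact: span_subset.
have /choice [D DE] a : exists c : 'I_m -> C, x a = \sum_i c i *: e i.
  by have := UrU (Ux a); rewrite -eU.
apply: (@mulmx1_min C k m (\matrix_(a, i) D a i)
  (\matrix_(i, b) beta (e i) (x b))).
apply/matrixP => a b; rewrite !mxE -x1 [in RHS]DE form_sum //; last exact: UrU.
by apply: eq_bigr => i _; rewrite !mxE.
Qed.

(** One Gram-Schmidt step: the remainder of Y is nonzero, orthogonal to all x, and still in [Ur]
    because the coefficients are real. *)
Lemma orthonormal_extend k (x : 'I_k -> V) Y : real_orthonormal x -> Ur Y ->
  Y != \sum_a beta Y (x a) *: x a ->
  exists z : 'I_k.+1 -> V, real_orthonormal z.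
Proof.
move=> [Ux x1] UY; rewrite -subr_eq0; set S := \sum_a _.
set Y' := Y - S => nY'; have Uux a := UrU (Ux a); have uY := UrU UY.
have US : Ur S.
  rewrite /S; elim/big_ind: _ => [|X Z UX UZ|a _]; first exact: real_part0.
    by rewrite -[X]scale1r; apply: Ur_linear; rewrite ?rmorph1.
  rewrite -[_ *: _]addr0; apply: Ur_linear => //; last exact: real_part0.
  exact: form_real.
have UY' : Ur Y'.
  by rewrite /Y' addrC -scaleN1r; apply: Ur_linear; rewrite ?rmorphN1.
have Y'x b : beta Y' (x b) = 0.
  rewrite /Y' addrC -scaleN1r beta_linear //; last exact: UrU.
  rewrite form_sum // (bigD1 b) //= big1 => [|a ab].
    by rewrite x1 eqxx mulr1 addr0 mulN1r addNr.
  by rewrite x1 (negPf ab) mulr0.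
have q0 := beta_pos UY' nY'; set q := beta Y' Y' in q0.
(* Positivity of q makes c real, so that normalizing does not leave [Ur]. *)
pose c := (sqrtC q)^-1.
have c_real : c^* = c.
  by apply/CrealP; rewrite ger0_real // invr_ge0 sqrtC_ge0 ltW.
have ccq : c * (c * q) = 1.
  rewrite mulrA -expr2 exprVn sqrtCK mulVf //; exact: lt0r_neq0.
have Uz : Ur (c *: Y').
  by rewrite -[_ *: _]addr0; apply: Ur_linear => //; apply: real_part0.
have zz : beta (c *: Y') (c *: Y') = 1.
  have [UUz UUY'] := (UrU Uz, UrU UY').
  by rewrite formZ // beta_sym // formZ.
have zx b : beta (c *: Y') (x b) = 0.
  by rewrite formZ ?Y'x ?mulr0 //; apply: UrU.
exists (fun a => if unlift ord0 a is Some b then x b else c *: Y').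
split=> [a|a b]; first by case: unliftP.
case: (unliftP ord0 a) => [a' ->|->]; case: (unliftP ord0 b) => [b' ->|->].
- by rewrite x1 (inj_eq lift_inj).
- by rewrite beta_sym ?zx //; apply: UrU.
- by rewrite zx.
- by rewrite zz eqxx.
Qed.

(** Orthonormal families have bounded length, and one of maximal length expands every vector of
    [Ur], otherwise it could be extended. Complex linearity carries the expansion to U = [Ur] + i
    [Ur]. *)
Lemma real_orthonormal_basis m (e : 'I_m -> V) : lin_span e = U ->
  exists k (x : 'I_k -> V), real_orthonormal x /\
    forall X, U X -> X = \sum_a beta X (x a) *: x a.
Proof.
move=> eU; pose P k := `[< exists x : 'I_k -> V, real_orthonormal x >].
have exP : exists k, P k.
  by exists 0%N; apply/asboolP; exists (fun=> 0); split=> [[]|[]].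
have leP k : P k -> (k <= m)%N.
  by move=> /asboolP [x /(orthonormal_size eU)].
case: (ex_maxnP exP leP) => k /asboolP [x ox] kmax.
exists k, x; split=> // X UX; have Uux a := UrU (ox.1 a).
have expand Y : Ur Y -> Y = \sum_a beta Y (x a) *: x a.
  move=> UY; apply/eqP/negPn/negP => nY.
  have [z oz] := orthonormal_extend ox UY nY.
  by have /kmax : P k.+1 by [apply/asboolP; exists z]; rewrite ltnn.
have [A [B [UA UB XE]]] := U_real UX.
have [uA uB] := (UrU UA, UrU UB).
rewrite {1}XE {1}(expand A) // {1}(expand B) // scaler_sumr -big_split.
apply: eq_bigr => a _ /=; rewrite scalerA -scalerDl XE [A + _]addrC beta_linear //.
by rewrite addrC.
Qed.

Lemma orthonormal_parseval k (x : 'I_k -> V) X Y :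
  real_orthonormal x -> (forall X, U X -> X = \sum_a beta X (x a) *: x a) ->
  U X -> U Y -> beta X Y = \sum_a beta X (x a) * beta Y (x a).
Proof.
move=> [Ux _] expand UX UY; have Uux a := UrU (Ux a).
rewrite {1}(expand X) // form_sum //; apply: eq_bigr => a _.
by rewrite [beta Y _]beta_sym.
Qed.

(** With A and B the coordinate matrices of e and e', duality gives A B^T = 1, while B^T A = 1 is
    wanted. As e spans, A also has a left inverse, which must then be B^T; no comparison of k with m
    is required. *)
Lemma dual_basis_change k (x : 'I_k -> V) m (e e' : 'I_m -> V) a b :
  real_orthonormal x -> (forall X, U X -> X = \sum_a beta X (x a) *: x a) ->
  lin_span e = U -> (forall i, U (e' i)) ->
  (forall i j, beta (e i) (e' j) = (i == j)%:R) ->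
  \sum_p beta (e p) (x a) * beta (e' p) (x b) = (a == b)%:R.
Proof.
move=> ox expand eU Ue' dual; have [Ux x1] := ox; have Uux c := UrU (Ux c).
have Ue i : U (e i) by exact: span_subset.
pose A := \matrix_(p, a) beta (e p) (x a).
pose B := \matrix_(p, a) beta (e' p) (x a).
have AB : A *m B^T = 1%:M.
  apply/matrixP => i j; rewrite !mxE -dual (orthonormal_parseval ox) //.
  by apply: eq_bigr => c _; rewrite !mxE.
have /choice [D DE] c : exists d : 'I_m -> C, x c = \sum_i d i *: e i.
  by have := Uux c; rewrite -eU.
have DA : (\matrix_(c, i) D c i) *m A = 1%:M.
  apply/matrixP => c d; rewrite !mxE -x1 [in RHS]DE form_sum //.
  by apply: eq_bigr => i _; rewrite !mxE.
have BA : B^T *m A = 1%:M.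
  by rewrite -[LHS]mul1mx -{1}DA -mulmxA (mulmxA A) AB mul1mx.
have /matrixP /(_ b a) := BA; rewrite !mxE eq_sym => <-.
by apply: eq_bigr => p _; rewrite !mxE mulrC.
Qed.

End OrthonormalBasis.

(** * The square of the Dirac operator *)

Section DiracSquare.
Variables (R : realType) (V : lmodType (Cplx R)).
Local Notation C := (Cplx R).

(** A predicate, because [gact E Z] is a bare function known to be linear only for Z in [g0]. *)
Definition linear_op (T : V -> V) : Prop :=
  forall (a : C) u v, T (a *: u + v) = a *: T u + T v.

Lemma linear_op0 T : linear_op T -> T 0 = 0.
Proof.
by move=> lT; have := lT (-1) 0 0; rewrite scaler0 addr0 scaleN1r addNr.
Qed.

Lemma linear_opZ T a u : linear_op T -> T (a *: u) = a *: T u.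
Proof. by move=> lT; rewrite -[a *: u]addr0 lT linear_op0 // addr0. Qed.

Lemma linear_op_sum T (I : finType) (u : I -> V) :
  linear_op T -> T (\sum_i u i) = \sum_i T (u i).
Proof.
move=> lT; apply: (big_morph T) => [x y|]; last exact: linear_op0.
by rewrite -[x]scale1r lT !scale1r.
Qed.

Variables (s m : nat) (T : 'I_m -> V -> V) (gamma : 'I_m -> 'M[C]_s).
Variable g : 'I_m -> 'I_m -> C.
Hypotheses (T_linear : forall p, linear_op (T p))
  (T_comm : forall p q v, T p (T q v) = T q (T p v))
  (gamma_square : forall p q,
     gamma p *m gamma q + gamma q *m gamma p = (g p q)%:M).

Let D (w : {ffun 'I_s -> V}) := \sum_p tensor_op (T p) (gamma p) w.

Lemma dirac_coord w i : D w i = \sum_p \sum_j gamma p i j *: T p (w j).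
Proof. by rewrite sum_ffunE; apply: eq_bigr => p _; rewrite ffunE. Qed.

(** Since the T commute, the double sum for D^2 may be symmetrized in p and q, which leaves only
    anticommutators of the gamma. Doubling avoids the factor 1/2. *)
Lemma dirac_square w i :
  D (D w) i *+ 2 = \sum_p \sum_q g p q *: T p (T q (w i)).
Proof.
have DD : D (D w) i =
    \sum_p \sum_q \sum_l (gamma p *m gamma q) i l *: T p (T q (w l)).
  rewrite dirac_coord; apply: eq_bigr => p _.
  transitivity (\sum_j \sum_q \sum_l
      (gamma p i j * gamma q j l) *: T p (T q (w l))).
    apply: eq_bigr => j _; rewrite dirac_coord linear_op_sum // scaler_sumr.
    apply: eq_bigr => q _; rewrite linear_op_sum // scaler_sumr.
    by apply: eq_bigr => l _; rewrite linear_opZ // scalerA.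
  rewrite exchange_big; apply: eq_bigr => q _; rewrite exchange_big.
  by apply: eq_bigr => l _; rewrite mxE scaler_suml.
have DD' : D (D w) i =
    \sum_p \sum_q \sum_l (gamma q *m gamma p) i l *: T p (T q (w l)).
  rewrite DD exchange_big; apply: eq_bigr => p _; apply: eq_bigr => q _.
  by apply: eq_bigr => l _; rewrite T_comm.
rewrite mulr2n {1}DD DD' -big_split; apply: eq_bigr => p _.
rewrite -big_split; apply: eq_bigr => q _ /=; rewrite -big_split /=.
transitivity (\sum_l (g p q)%:M i l *: T p (T q (w l))).
  by apply: eq_bigr => l _; rewrite -scalerDl -gamma_square [in RHS]mxE.
rewrite (bigD1 i) //= big1 => [|l /negPf li].
  by rewrite mxE eqxx mulr1n addr0.
by rewrite mxE eq_sym li mulr0n scale0r.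
Qed.

(** In matrix terms g = B B^T and A^T B = 1, so A^T g A = (A^T B) (A^T B)^T = 1: in terms of the X
    the quadratic expression is a plain sum of squares. *)
Lemma gram_change k (X : 'I_k -> V -> V) (A B : 'I_m -> 'I_k -> C) v :
  (forall a, linear_op (X a)) ->
  (forall p u, T p u = \sum_a A p a *: X a u) ->
  (forall p q, g p q = \sum_a B p a * B q a) ->
  (forall a b, \sum_p A p a * B p b = (a == b)%:R) ->
  \sum_p \sum_q g p q *: T p (T q v) = \sum_a X a (X a v).
Proof.
move=> lX TE gE AB.
transitivity (\sum_a \sum_b
    (\sum_p \sum_q g p q * A p a * A q b) *: X a (X b v)).
  have E p q : g p q *: T p (T q v) =
      \sum_a \sum_b (g p q * A p a * A q b) *: X a (X b v).
    rewrite TE scaler_sumr; apply: eq_bigr => a _.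
    rewrite TE (linear_op_sum _ (lX a)) !scaler_sumr; apply: eq_bigr => b _.
    by rewrite (linear_opZ _ _ (lX a)) !scalerA.
  under eq_bigr => p _ do under eq_bigr => q _ do rewrite E.
  under eq_bigr => p _ do rewrite exchange_big.
  rewrite exchange_big; apply: eq_bigr => a _.
  under eq_bigr => p _ do rewrite exchange_big.
  rewrite exchange_big; apply: eq_bigr => b _.
  by rewrite scaler_suml; apply: eq_bigr => p _; rewrite scaler_suml.
have E a b : \sum_p \sum_q g p q * A p a * A q b = (a == b)%:R.
  transitivity (\sum_c (\sum_p A p a * B p c) * (\sum_q A q b * B q c)).
    under eq_bigr => p _ do under eq_bigr => q _ do rewrite gE !mulr_suml.
    under eq_bigr => p _ do rewrite exchange_big.
    rewrite exchange_big; apply: eq_bigr => c _; rewrite mulr_suml.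
    apply: eq_bigr => p _; rewrite mulr_sumr; apply: eq_bigr => q _; ring.
  rewrite (bigD1 a) //= [X in _ + X]big1 => [|c /negPf ca]; rewrite !AB ?eqxx.
    by rewrite mul1r addr0 eq_sym.
  by rewrite eq_sym ca mul0r.
apply: eq_bigr => a _; rewrite (bigD1 a) //= E eqxx scale1r.
rewrite [X in _ + X]big1 ?addr0 // => b.
by rewrite E eq_sym => /negPf ->; rewrite scale0r.
Qed.

End DiracSquare.

(** * Modules over the motion group *)

Section Modules.
Variables (R : realType) (n : nat) (G : set 'M[Cplx R]_n).
Variables (theta : 'M[Cplx R]_n -> 'M[Cplx R]_n).
Variables (V : lmodType (Cplx R)) (E : g0K_module G theta V).
Local Notation C := (Cplx R).
Local Notation M := 'M[Cplx R]_n.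
Local Notation p0 := (pspace G theta).

Lemma gact_op Z : g0 G theta Z -> linear_op (gact E Z).
Proof. by move=> gZ a u v; apply: gact_linear. Qed.

Hypothesis reg_theta : regular_on G theta.

Lemma pspace_subspace : is_subspace p0.
Proof.
split=> [|a X Y]; last exact: pspace_linear.
have [P thetaP] := reg_theta; apply/(pspaceP _ thetaP); split; first exact: lie0.
by rewrite dmap0 oppr0.
Qed.

Lemma g0_p X : p0 X -> g0 G theta (0, X).
Proof. by move=> pX; split=> //; apply: lie0. Qed.

Lemma g0_k Y : lie (Kgroup G theta) Y -> g0 G theta (Y, 0).
Proof. by move=> kY; split=> //; apply: pspace_subspace.1. Qed.

Lemma gact_p_linear a X Y v : p0 X -> p0 Y ->
  gact E (0, a *: X + Y) v = a *: gact E (0, X) v + gact E (0, Y) v.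
Proof.
move=> pX pY; rewrite -gact_linearl; [|exact: g0_p..].
congr (gact E _ v); congr (_, _) => /=.
by rewrite scaler0 addr0.
Qed.

Lemma gact_p0 v : gact E (0, 0) v = 0.
Proof.
have p00 := pspace_subspace.1.
by have := gact_p_linear (-1) v p00 p00; rewrite scaler0 addr0 scaleN1r addNr.
Qed.

Lemma gact_p_sum k (c : 'I_k -> C) (x : 'I_k -> M) v : (forall a, p0 (x a)) ->
  gact E (0, \sum_a c a *: x a) v = \sum_a c a *: gact E (0, x a) v.
Proof.
move=> px; suff [] : p0 (\sum_a c a *: x a) /\
  gact E (0, \sum_a c a *: x a) v = \sum_a c a *: gact E (0, x a) v by [].
elim/big_ind2: _ => [|X u Y w [pX <-] [pY <-]|a _].
- by split; [exact: pspace_subspace.1|exact: gact_p0].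
- split; first exact: subspaceD pspace_subspace _ _ _ _.
  by rewrite -[X in (0, X + _)]scale1r gact_p_linear // scale1r.
- split; first exact: subspaceZ pspace_subspace _ _ _.
  rewrite -[c a *: x a]addr0 gact_p_linear //; last exact: pspace_subspace.1.
  by rewrite gact_p0 addr0.
Qed.

Lemma gact_split Z v : g0 G theta Z ->
  gact E Z v = gact E (Z.1, 0) v + gact E (0, Z.2) v.
Proof.
case: Z => Y X [kY pX]; rewrite -[gact E (Y, 0) v]scale1r.
rewrite -gact_linearl; [|exact: g0_k|exact: g0_p].
congr (gact E _ v); congr (_, _) => /=.
  by rewrite scale1r addr0.
by rewrite scaler0 add0r.
Qed.

Lemma lbr0l (X : M) : lbr 0 X = 0.
Proof. by rewrite /lbr mul0mx mulmx0 subrr. Qed.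

Lemma gact_p_comm X Y v : p0 X -> p0 Y ->
  gact E (0, X) (gact E (0, Y) v) = gact E (0, Y) (gact E (0, X) v).
Proof.
move=> pX pY; apply/eqP; rewrite -subr_eq0; apply/eqP.
rewrite -gact_bracket; [|exact: g0_p..].
rewrite /g0_bracket /= !lbr0l add0r.
have -> : lbr X 0 = 0 by rewrite /lbr mul0mx mulmx0 subrr.
exact: gact_p0.
Qed.

Lemma p0_trivial_of_fixed_vector m (b : 'I_m -> M) v :
  alg_group G -> group_involution G theta -> lin_span b = p0 ->
  irreducible E -> v != 0 -> (forall X, p0 X -> gact E (0, X) v = 0) ->
  p0_trivial E.
Proof.
move=> algG thetaG bp [_ irr] nv v0.
pose U : set V := [set u | forall X, p0 X -> gact E (0, X) u = 0].
have [||| U0|UT] := irr U.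
- split=> [X pX|a u w Uu Uw X pX]; first exact/linear_op0/gact_op/g0_p.
  by rewrite gact_linear ?Uu ?Uw // ?scaler0 ?addr0 //; apply: g0_p.
(* For Z = (Y, X'), X Z u = [X, Z] u + Z X u = [X, Z] u, and the bracket is [X, Y], which lies in
   p. *)
- move=> [Y X'] u gZ Uu X pX; have gX := g0_p pX; have kY : lie _ Y := gZ.1.
  have := gact_bracket E gX gZ u.
  rewrite (Uu _ pX) (linear_op0 (gact_op gZ)) subr0 => <-.
  rewrite /g0_bracket /= !lbr0l add0r.
  have -> : lbr X Y = - lbr Y X by rewrite /lbr opprB.
  rewrite Uu // -scaleN1r; apply: subspaceZ; first exact: pspace_subspace.
  by apply: (lbr_stable bp _ kY pX) => k Z Kk; apply: Ad_pspace.
(* Here X k u = k (Ad(k^-1) X) u, and Ad(k^-1) X is again in p. *)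
- move=> k u Kk Uu X pX; have uk := Kgroup_unit algG Kk.
  have pX' : p0 (Ad (invmx k) X).
    by apply: Ad_pspace => //; apply: KgroupV.
  rewrite -(AdK X uk).
  have := compat_Ad E Kk (g0_p pX') u; rewrite /g0_Ad /=.
  have -> : Ad k 0 = 0 by rewrite /Ad mulmx0 mul0mx.
  move=> <-; rewrite Uu //.
  by apply: (linear_op0 (T := kact E k)) => a w z; apply: kact_linear.
- by have : U v by []; rewrite U0 => /eqP; rewrite (negPf nv).
- by move=> X u pX; have : U u by [rewrite UT]; apply.
Qed.

Lemma irreducible_p0_trivial_finite_dim :
  irreducible E -> p0_trivial E -> finite_dim V.
Proof.
move=> [[v nv] irr] triv.
have [m [b [F [mc bv]]]] := kact_locally_finite E v.
have lin_stable (T : V -> V) : linear_op T ->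
    (forall j, lin_span b (T (b j))) ->
    forall u, lin_span b u -> lin_span b (T u).
  move=> lT /choice [c cE] _ [d ->].
  exists (fun i => \sum_j d j * c j i).
  rewrite linear_op_sum //.
  under eq_bigr => j _ do rewrite linear_opZ // cE scaler_sumr.
  rewrite exchange_big; apply: eq_bigr => i _; rewrite scaler_suml.
  by apply: eq_bigr => j _; rewrite scalerA.
exists m, b; have [||| U0|//] := irr (lin_span b).
- split=> [|a _ _ [c ->] [d ->]].
    by exists (fun=> 0); rewrite big1 // => i _; rewrite scale0r.
  exists (fun i => a * c i + d i); rewrite scaler_sumr -big_split.
  by apply: eq_bigr => i _; rewrite scalerDl scalerA.
(* Only the k-component of Z acts, and it acts on the b through derivatives of the matrix
   coefficients of K. *)
- move=> Z u gZ; rewrite gact_split // triv ?addr0; last exact: gZ.2.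
  apply: lin_stable; first exact/gact_op/g0_k/gZ.1.
  move=> j; exists (fun i => dregfun (F i j) Z.1).
  exact: (compat_diff mc gZ.1).
- move=> k u Kk; apply: lin_stable => [a x y|j]; first exact: kact_linear.
  by exists (fun i => regfun (F i j) k); exact: mc.2.
- by move: bv; rewrite U0 => /eqP; rewrite (negPf nv).
Qed.

End Modules.

(** * The kernel of the Dirac operator *)

Lemma gamma0_anticommutator (R : realType) n (G : set 'M[Cplx R]_n) theta beta s
    (rho : {rmorphism clifford G theta beta -> 'M[Cplx R]_s})
    (X Y : pspace G theta) :
  (forall a, rho (pa_cst _ a) = a%:M) ->
  rho (gamma0 beta X) *m rho (gamma0 beta Y) +
  rho (gamma0 beta Y) *m rho (gamma0 beta X) = (beta (val X) (val Y))%:M.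
Proof.
move=> rho_cst; have rhoM a b : rho a *m rho b = rho (a * b).
  by rewrite rmorphM.
rewrite -rho_cst !rhoM -rmorphD.
congr (rho _); rewrite /gamma0 /pa_gen.
(* The ring operations are unfolded to those on classes, so that the Clifford relation applies to
   representatives. *)
transitivity (pa_add (pa_mul (pa_gen (clifford_rel beta) X) (pa_gen _ Y))
                     (pa_mul (pa_gen _ Y) (pa_gen _ X))); first by [].
rewrite /pa_gen !pa_mulE pa_addE; apply/presalg_eqP/ac_rel.
exact: cl_square.
Qed.

Section DiracKernel.
Variables (R : realType) (n : nat).
Variables (G : set 'M[Cplx R]_n) (sigma theta : 'M[Cplx R]_n -> 'M[Cplx R]_n).
Variables (beta : 'M[Cplx R]_n -> 'M[Cplx R]_n -> Cplx R).
Variables (s : nat) (spin : {rmorphism clifford G theta beta -> 'M[Cplx R]_s}).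
Variables (m : nat) (e e' : 'I_m -> pspace G theta).
Variables (V : lmodType (Cplx R)) (E : g0K_module G theta V).
Hypotheses (algG : alg_group G) (sigmaG : real_structure G sigma).
Hypotheses (cartan : cartan_involution G sigma theta).
Hypotheses (form : admissible_form G sigma theta beta).
Hypotheses (spin_simple : simple_module spin) (dual : dual_bases beta e e').
Hypothesis unitary : inf_unitary sigma E.
Local Notation p0 := (pspace G theta).
Local Notation D := (dirac E spin e e').

Lemma kernel_dirac_fixed w i : D w = 0 ->
  forall X, p0 X -> gact E (0, X) (w i) = 0.
Proof.
have [thetaG regt _ _] := cartan; have [spin_cst _ _] := spin_simple.
have [[_ eU] [_ e'U] dual1] := dual.
have pe' p : p0 (val (e' p)) by exact: set_valP.
have pe p : p0 (val (e p)) by exact: set_valP.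
have psub := pspace_subspace regt.
have rsub : real_form G sigma p0 `<=` p0 by move=> X [].
have blin a X Y Z : p0 X -> p0 Y -> p0 Z ->
    beta (a *: X + Y) Z = a * beta X Z + beta Y Z.
  by move=> [gX _] [gY _] [gZ _]; apply: (form_linear form).
have bsym X Y : p0 X -> p0 Y -> beta X Y = beta Y X.
  by move=> [gX _] [gY _]; apply: (form_sym form).
have rlin a X Y : a^* = a -> real_form G sigma p0 X -> real_form G sigma p0 Y ->
    real_form G sigma p0 (a *: X + Y) by exact: real_pspace_linear.
have bpos X : real_form G sigma p0 X -> X != 0 -> 0 < beta X X.
  exact: form_pos form _.
have dec X : p0 X -> exists A B, [/\ real_form G sigma p0 A,
    real_form G sigma p0 B & X = A + 'i *: B].
  exact: pspace_real_decomposition.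
have [k [x [ox expand]]] :=
  real_orthonormal_basis psub blin bsym rsub rlin bpos dec eU.
have px a : p0 (x a) by exact/rsub/ox.1.
have gx a : g0 G theta (0, x a) by exact: g0_p.
have lT p : linear_op (gact E (0, val (e p))) by exact/gact_op/g0_p.
have lX a : linear_op (gact E (0, x a)) by exact: gact_op.
have comm p q v : gact E (0, val (e p)) (gact E (0, val (e q)) v) =
    gact E (0, val (e q)) (gact E (0, val (e p)) v) by exact: gact_p_comm.
have anti p q := gamma0_anticommutator (e' p) (e' q) spin_cst.
have TE p u : gact E (0, val (e p)) u =
    \sum_a beta (val (e p)) (x a) *: gact E (0, x a) u.
  by rewrite {1}(expand _ (pe p)) gact_p_sum.
have gE p q :=
  orthonormal_parseval psub blin bsym rsub ox expand (pe' p) (pe' q).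
have AB a b := dual_basis_change psub blin bsym rsub a b ox expand eU pe' dual1.
move=> Dw; have := dirac_square lT comm anti w i.
rewrite (gram_change _ lX TE gE AB).
have -> : \sum_p tensor_op (gact E (0, val (e p)))
    (spin (gamma0 beta (e' p))) w = 0 by exact: Dw.
have -> : \sum_p tensor_op (gact E (0, val (e p)))
    (spin (gamma0 beta (e' p))) 0 = 0.
  apply: big1 => p _; apply/ffunP => j; rewrite !ffunE big1 // => l _.
  by rewrite ffunE linear_op0 // scaler0.
(* What remains of D(D w) = 0 is that the sum of the squares of the X_a kills [w i]. *)
rewrite ffunE mul0rn => /esym laplace0.
have [h [[hlin hsym] hpos _ hskew]] := unitary.
have h0 v : h 0 v = 0.
  by have := hlin (-1) 0 0 v; rewrite scaler0 addr0 mulN1r addNr.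
have hD u v z : h (u + v) z = h u z + h v z.
  by rewrite -[u]scale1r hlin mul1r scale1r.
have hge0 v : 0 <= h v v.
  by have [->|/hpos/ltW //] := eqVneq v 0; rewrite h0.
have skew a u v : h (gact E (0, x a) u) v = - h u (gact E (0, x a) v).
  apply: hskew; split; last exact: ox.1.
  have [_ [F sigmaF]] := sigmaG; split; first exact: lie0.
  apply/(differentialP _ sigmaF); first exact: lie0.
  by rewrite dmap0 /mxconj raddf0.
have Xw a : gact E (0, x a) (w i) = 0.
  (* By skewness the sum of the |X_a w_i|^2 is minus the pairing of the sum of the X_a^2 w_i with
     w_i; its terms are nonnegative, so each vanishes. *)
  have sum0 : \sum_a h (gact E (0, x a) (w i)) (gact E (0, x a) (w i)) = 0.
    rewrite -[LHS]opprK -sumrN.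
    under eq_bigr => b _ do rewrite -skew.
    rewrite -(big_morph (h ^~ (w i)) (fun u v => hD u v _) (h0 _)).
    by rewrite laplace0 h0 oppr0.
  apply/eqP/negPn/negP => /hpos /lt0r_neq0 /eqP; apply.
  by apply: (psumr_eq0P _ sum0).
move=> X pX; rewrite (expand X pX) gact_p_sum // big1 // => a _.
by rewrite Xw scaler0.
Qed.

Lemma dirac_p0_trivial w : p0_trivial E -> D w = 0.
Proof.
move=> triv; apply: big1 => p _; apply/ffunP => j.
rewrite !ffunE big1 // => l _.
by rewrite triv ?scaler0 //; apply: set_valP.
Qed.

End DiracKernel.

(** * The Dirac series of the motion group *)

Theorem theorem2p6 (R : realType) (n : nat)
    (G : set 'M[Cplx R]_n) (sigma theta : 'M[Cplx R]_n -> 'M[Cplx R]_n)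
    (beta : 'M[Cplx R]_n -> 'M[Cplx R]_n -> Cplx R)
    (s : nat) (spin : {rmorphism clifford G theta beta -> 'M[Cplx R]_s})
    (m : nat) (e e' : 'I_m -> pspace G theta)
    (V : lmodType (Cplx R)) (E : g0K_module G theta V) :
  alg_group G -> zconnected G -> reductive G ->
  real_structure G sigma ->
  connected (realgroup G sigma) -> ~ compact (realgroup G sigma) ->
  cartan_involution G sigma theta ->
  admissible_form G sigma theta beta ->
  simple_module spin ->
  dual_bases beta e e' ->
  irreducible E -> inf_unitary sigma E ->
  (cohomology_neq0 (dirac E spin e e') <-> p0_trivial E)
  /\ (cohomology_neq0 (dirac E spin e e') -> finite_dim V).
Proof.
move=> algG _ _ sigmaG _ _ cartan form spin_simple dual irr unitary.
have [thetaG regt _ _] := cartan; have [_ s_gt0 _] := spin_simple.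
have [[v nv] _] := irr; have [[_ eU] _ _] := dual.
have coh_trivial : cohomology_neq0 (dirac E spin e e') -> p0_trivial E.
  move=> coh; apply: contrapT => ntriv; apply: coh => w /= Dw.
  (* The vector w = 0 is its own preimage, so a trivial kernel leaves no cohomology. *)
  suff w0 : w = 0 by split=> //; exists w => //; rewrite -[RHS]w0 in Dw *.
  apply/ffunP => i; rewrite [RHS]ffunE; apply/eqP/negPn/negP => nwi.
  apply/ntriv/(p0_trivial_of_fixed_vector regt algG thetaG eU irr nwi).
  exact: (kernel_dirac_fixed algG sigmaG cartan form spin_simple dual unitary).
split; last by move=> /coh_trivial; apply: irreducible_p0_trivial_finite_dim.
split=> // triv coh; have D0 w : dirac E spin e e' w = 0.
  exact: dirac_p0_trivial.
(* When D = 0, the constant family v lies in the kernel. Were it in the image, v would be 0; a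
   component to compare exists because the spin module is nonzero. *)
have [_ [w _]] := coh [ffun=> v] (D0 _).
rewrite D0 => /ffunP /(_ (Ordinal s_gt0)) /esym /eqP.
by rewrite !ffunE (negPf nv).
Qed.
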